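(* For all real $\lambda\ge 0$ and $\epsilon>0$ there exists a spherically symmetric pair $(A,\phi)$, consisting of a connection $A$ on the trivial principal $SU(2)$-bundle over the unit ball $B^3\subset\mathbb{R}^3$ and a Higgs field $\phi$ (a section of the adjoint bundle), which solves the boundary value problem $$\begin{cases}\epsilon\, *D_A*F=[D_A\phi,\phi] & \text{on } B^3,\\ *D_A*D_A\phi=\frac{\lambda}{2}(|\phi|^2-1)\phi & \text{on } B^3,\\ (D_A\phi)_\tau=0 & \text{on }\partial B^3,\\ |\phi|=1 & \text{on }\partial B^3.\end{cases}$$
   Context: $B^3$ is the unit ball in $\mathbb{R}^3$ with the Euclidean metric, and $*$ is the Hodge star. The bundle is $P=B^3\times SU(2)$. The Lie algebra $su(2)$ is identified with the imaginary quaternions $\mathrm{Im}\,\mathbb{H}=\{x_1i+x_2j+x_3k\}\cong\mathbb{R}^3$, with the Lie bracket $[X,Y]=XY-YX$ (so $[i,j]=2k$, etc.) and the norm $|\cdot|$ for which $i,j,k$ are orthonormal. A connection $A$ is a 1-form on $B^3$ with values in $\mathrm{Im}\,\mathbb{H}$; a Higgs field is a map $\phi:B^3\to\mathrm{Im}\,\mathbb{H}$. The curvature is $F=dA+A\wedge A$, i.e. $F_{ab}=\partial_aA_b-\partial_bA_a+[A_a,A_b]$. The covariant derivative is $D_A\phi=d\phi+[A,\phi]$, and $D_A$ extends to $\mathrm{Im}\,\mathbb{H}$-valued forms as the covariant exterior derivative. The subscript $\tau$ denotes the component of a 1-form tangential to $\partial B^3=S^2$. The group $SO(3)$ acts on pairs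 $(A,\phi)$ by simultaneously rotating the base $B^3\subset\mathbb{R}^3$ and the Lie algebra $\mathrm{Im}\,\mathbb{H}\cong\mathbb{R}^3$: for $R\in SO(3)$, $(R\cdot\phi)(x)=R\,\phi(R^{-1}x)$ and $(R\cdot A)_x(v)=R\,A_{R^{-1}x}(R^{-1}v)$. A pair is (spherically) symmetric if it is invariant under this action. In particular a symmetric Higgs field has the form $\phi(x)=\frac{\varphi(r)}{r}(x_1i+x_2j+x_3k)$ with $r=|x|$ and $\varphi$ a real-valued function, so $|\phi(x)|=|\varphi(r)|$. A solution means a classical solution: $A$ and $\phi$ are twice continuously differentiable in the interior of $B^3$ (including at the origin) and continuously differentiable up to the boundary, and the equations hold pointwise. *)

(* Defs.v *)
From mathcomp Require Import all_boot all_order all_algebra.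
From mathcomp Require Import all_classical all_reals all_analysis.

Set Implicit Arguments.
Unset Strict Implicit.
Unset Printing Implicit Defensive.

Import Order.TTheory GRing.Theory Num.Theory.
Import numFieldNormedType.Exports.

Local Open Scope classical_set_scope.
Local Open Scope ring_scope.

(* The library norm `|x| on matrices is the sup norm; it induces the right
   topology, but the Euclidean norm needed for the ball, for the sphere and for
   |phi| is [enorm]. *)
Definition dotv {R : realType} (u v : 'cV[R]_3) : R := \sum_i u i 0 * v i 0.

Definition enorm {R : realType} (u : 'cV[R]_3) : R := Num.sqrt (dotv u u).

Definition evec {R : realType} (a : 'I_3) : 'cV[R]_3 := delta_mx a 0.

Definition oball (R : realType) : set 'cV[R]_3 := [set x | enorm x < 1].
Definition cball (R : realType) : set 'cV[R]_3 := [set x | enorm x <= 1].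
Definition sphere2 (R : realType) : set 'cV[R]_3 := [set x | enorm x = 1].

(* Levi-Civita symbol; the Vandermonde product over indices 0, 1, 2 takes only
   the values 2, -2 and 0. *)
Definition levi {R : realType} (a b c : 'I_3) : R :=
  (b%:R - a%:R) * (c%:R - a%:R) * (c%:R - b%:R) / 2.

Definition cross {R : realType} (u v : 'cV[R]_3) : 'cV[R]_3 :=
  \col_a \sum_b \sum_c levi a b c * u b 0 * v c 0.

(* A quaternion is a pair (real part, imaginary part), with Hamilton's product;
   Im H is 'cV[R]_3, the columns evec 0, evec 1, evec 2 being i, j, k. *)
Definition qmul {R : realType} (p q : R * 'cV[R]_3) : R * 'cV[R]_3 :=
  (p.1 * q.1 - dotv p.2 q.2, p.1 *: q.2 + q.1 *: p.2 + cross p.2 q.2).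

(* XY - YX for X, Y in Im H; its real part is 0. *)
Definition lie {R : realType} (X Y : 'cV[R]_3) : 'cV[R]_3 :=
  (qmul (0, X) (0, Y) - qmul (0, Y) (0, X)).2.

(* Im H-valued forms on R^3, by components in the standard coframe: F a b is
   F(e_a, e_b), so that F = 1/2 sum_ab F_ab dx_a /\ dx_b, and similarly in
   degree 3. Only the values on the closed unit ball are ever constrained. *)
Definition form0 (R : realType) := 'cV[R]_3 -> 'cV[R]_3.
Definition form1 (R : realType) := 'I_3 -> 'cV[R]_3 -> 'cV[R]_3.
Definition form2 (R : realType) := 'I_3 -> 'I_3 -> 'cV[R]_3 -> 'cV[R]_3.
Definition form3 (R : realType) :=
  'I_3 -> 'I_3 -> 'I_3 -> 'cV[R]_3 -> 'cV[R]_3.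

Definition eval1 {R : realType} (w : form1 R) (x v : 'cV[R]_3) : 'cV[R]_3 :=
  \sum_a v a 0 *: w a x.

Definition star1 {R : realType} (w : form1 R) : form2 R :=
  fun b c x => \sum_a levi a b c *: w a x.

Definition star2 {R : realType} (G : form2 R) : form1 R :=
  fun c x => 2^-1 *: \sum_a \sum_b levi a b c *: G a b x.

Definition star3 {R : realType} (H : form3 R) : form0 R :=
  fun x => 6^-1 *: \sum_a \sum_b \sum_c levi a b c *: H a b c x.

Definition pd {R : realType} (a : 'I_3) (f : 'cV[R]_3 -> 'cV[R]_3)
    (x : 'cV[R]_3) : 'cV[R]_3 :=
  'D_(evec a) f x.

Definition curv {R : realType} (A : form1 R) : form2 R :=
  fun a b x => pd a (A b) x - pd b (A a) x + lie (A a x) (A b x).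

Definition covd0 {R : realType} (A : form1 R) (phi : form0 R) : form1 R :=
  fun a x => pd a phi x + lie (A a x) (phi x).

Definition covd1 {R : realType} (A w : form1 R) : form2 R :=
  fun a b x => (pd a (w b) x + lie (A a x) (w b x))
             - (pd b (w a) x + lie (A b x) (w a x)).

Definition covd2 {R : realType} (A : form1 R) (G : form2 R) : form3 R :=
  fun a b c x => (pd a (G b c) x + lie (A a x) (G b c x))
               + (pd b (G c a) x + lie (A b x) (G c a x))
               + (pd c (G a b) x + lie (A c x) (G a b x)).

Definition C1_on {R : realType} (U : set 'cV[R]_3)
    (f : 'cV[R]_3 -> 'cV[R]_3) : Prop :=
  forall a, (forall x, U x -> derivable f x (evec a)) /\
            (forall x, U x -> {for x, continuous (pd a f)}).

Definition C2_on {R : realType} (U : set 'cV[R]_3)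
    (f : 'cV[R]_3 -> 'cV[R]_3) : Prop :=
  C1_on U f /\ forall a, C1_on U (pd a f).

(* C^1 up to the boundary: f is continuous on the closed ball, C^1 in the open
   ball, and its partial derivatives extend continuously to the closed ball. *)
Definition C1_closed {R : realType} (f : 'cV[R]_3 -> 'cV[R]_3) : Prop :=
  [/\ {within @cball R, continuous f},
      C1_on (@oball R) f &
      forall a, exists g : 'cV[R]_3 -> 'cV[R]_3,
        {within @cball R, continuous g} /\
        (forall x, oball x -> g x = pd a f x)].

Definition classical_reg {R : realType} (f : 'cV[R]_3 -> 'cV[R]_3) : Prop :=
  C2_on (@oball R) f /\ C1_closed f.

Definition SO3 (R : realType) : set 'M[R]_3 :=
  [set Q | Q *m Q^T = 1%:M /\ \det Q = 1].

Definition rot_higgs {R : realType} (Q : 'M[R]_3) (phi : form0 R) : form0 R :=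
  fun x => Q *m phi (invmx Q *m x).

Definition rot_conn {R : realType} (Q : 'M[R]_3) (A : form1 R) : form1 R :=
  fun a x => Q *m eval1 A (invmx Q *m x) (invmx Q *m evec a).

Definition spherically_symmetric {R : realType}
    (A : form1 R) (phi : form0 R) : Prop :=
  forall Q, SO3 Q -> forall x, cball x ->
    rot_higgs Q phi x = phi x /\ forall a, rot_conn Q A a x = A a x.

(* w_tau = 0 on the boundary, for a 1-form w defined in the open ball through
   derivatives: the boundary value of w at x in S^2, i.e. its limit from inside
   the ball, vanishes on the vectors v tangent to S^2 at x. *)
Definition tangential_zero {R : realType} (w : form1 R) : Prop :=
  forall x v, sphere2 x -> dotv x v = 0 ->
    eval1 w y v @[y --> within (@oball R) (nbhs x)] --> (0 : 'cV[R]_3).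

Definition solves_bvp {R : realType} (lambda eps : R)
    (A : form1 R) (phi : form0 R) : Prop :=
  [/\ forall a x, oball x ->
        eps *: star2 (covd1 A (star2 (curv A))) a x
          = lie (covd0 A phi a x) (phi x),
      forall x, oball x ->
        star3 (covd2 A (star1 (covd0 A phi))) x
          = (lambda / 2 * (enorm (phi x) ^+ 2 - 1)) *: phi x,
      tangential_zero (covd0 A phi) &
      forall x, sphere2 x -> enorm (phi x) = 1].

(* Main.v *)
(** In the hedgehog ansatz [A_a = k(t) x * e_a] (cross product), [phi = s(t) x]
    with [t = |x|^2], both equations are radial. With [v = - 2 k] and
    [c = 4 / eps] they become
    [4 t v'' + 10 v' = - v^2 (3 - t v) - c s^2 (1 - t v)],
    [4 t s'' + 10 s' = - 2 v (2 - t v) s - lambda / 2 (1 - t s^2) s],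
    with [v 1 = s 1 = 1]; the left-hand sides are regular at [t = 0] because
    they are Laplacians in dimension 5. The system is cooperative on
    [0 <= t v <= 1], [0 <= t s^2 <= 1], so after adding a large multiple of the
    unknown on both sides the solution operator of the linear problem is
    monotone. The maximum principle, with explicit supersolutions, bounds it,
    and Tarski's argument gives a fixed point. *)

Require Import Defs.
From Stdlib Require Reals Lra Psatz.
From Coquelicot Require Coquelicot.

(** The pair [v = 1 / t], [s = 1 / sqrt t] solves the system exactly: it is the singular field for
    which [phi = x / |x|] is covariantly constant. The tangential condition reads
    [s (1 + 2 t k) = 0] at [t = 1], so with [s 1 = 1] it becomes [v 1 = 1]. The singular pair thus
    has the right boundary values, and it is the edge [t v = 1], [t s^2 = 1] of the cooperative
    range. The obstacle is that it blows up at the origin; the constants [cap_v] and [cap_s] provide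
    barriers that stay finite there.

    The multiple of the unknown added on both sides depends on [t]: with
    [shift mu t = 10 mu + 4 mu^2 t] the function [exp (mu t)] solves the homogeneous linear
    equation. Reduction of order then gives the solution by two integrations with positive weights,
    so that existence and monotonicity for the linear problem are read off a formula.

    The variable [t = |x|^2], instead of [|x|], lets a profile that is C^2 in [t] give fields that
    are C^2 at the origin. *)

Module Radial.

Import Reals Lra Psatz Coquelicot.
Set Bullet Behavior "Strict Subproofs".
Open Scope R_scope.

(** * Averaging operator *)

Definition radial_int (H : R -> R) (r : R) : R :=
  RInt (fun s => s ^ 4 * H (s ^ 2)) 0 r.

(** The bounded solution [w] of [4 t w' + 10 w = H]: it is [t^(-5/2)] times the integral of
    [u^(3/2) H(u) / 4] over [[0, t]], and [u = s^2] removes the fractional power. The value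
    [H 0 / 10] is the limit at [0]; keeping it for negative [t] makes the function continuous on the
    whole line. *)
Definition avg (H : R -> R) (t : R) : R :=
  if Rle_dec t 0 then H 0 / 10
  else radial_int H (sqrt t) / (2 * sqrt t ^ 5).

Lemma continuous_radial (H : R -> R) :
  (forall x, continuous H x) ->
  forall x, continuous (fun s => s ^ 4 * H (s ^ 2)) x.
Proof.
  intros HH x. apply (continuous_mult (fun s => s ^ 4) (fun s => H (s ^ 2))).
  - apply (ex_derive_continuous (fun s : R => s ^ 4)). auto_derive; auto.
  - apply (continuous_comp (fun s => s ^ 2) H); [|apply HH].
    apply (ex_derive_continuous (fun s : R => s ^ 2)). auto_derive; auto.
Qed.

Lemma ex_RInt_cont (f : R -> R) (a b : R) :
  (forall x, continuous f x) -> ex_RInt f a b.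
Proof.
  intros Hf. apply (ex_RInt_continuous (V := R_CompleteNormedModule)).
  intros; apply Hf.
Qed.

Lemma is_derive_RInt_cont (f : R -> R) (a x : R) :
  (forall y, continuous f y) -> is_derive (fun y => RInt f a y) x (f x).
Proof.
  intros Hf. apply (is_derive_RInt f _ a x); [|apply Hf].
  exists (mkposreal 1 Rlt_0_1). intros y _.
  apply (RInt_correct (V := R_CompleteNormedModule)), ex_RInt_cont, Hf.
Qed.

Lemma avg_le (H1 H2 : R -> R) (t : R) :
  (forall x, continuous H1 x) -> (forall x, continuous H2 x) ->
  0 <= t -> (forall u, 0 <= u <= t -> H1 u <= H2 u) -> avg H1 t <= avg H2 t.
Proof.
  intros c1 c2 t0 le. unfold avg. destruct (Rle_dec t 0) as [h|h].
  - assert (H1 0 <= H2 0) by (apply le; lra). lra.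
  - assert (0 < sqrt t) by (apply sqrt_lt_R0; lra).
    apply Rmult_le_compat_r.
    { apply Rlt_le, Rinv_0_lt_compat.
      apply Rmult_lt_0_compat; [lra|apply pow_lt; lra]. }
    apply RInt_le; try lra.
    + apply ex_RInt_cont, continuous_radial, c1.
    + apply ex_RInt_cont, continuous_radial, c2.
    + intros x hx. apply Rmult_le_compat_l; [apply pow_le; lra|].
      apply le. split; [apply pow2_ge_0|].
      rewrite <- (pow2_sqrt t) by lra. apply pow_incr; lra.
Qed.

(** Affine functions are the barriers that, through [avg_le], control [avg H] near [0] to first
    order. The 14 is 4 + 10, from inserting [w = b t / 14] into [4 t w' + 10 w = b t]. *)
Lemma avg_affine (a b t : R) :
  0 <= t -> avg (fun u => a + b * u) t = a / 10 + b * t / 14.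
Proof.
  intros t0. unfold avg. destruct (Rle_dec t 0) as [h|h].
  - replace t with 0 by lra. field.
  - assert (hs : 0 < sqrt t) by (apply sqrt_lt_R0; lra).
    unfold radial_int.
    assert (E : is_RInt (fun s => s ^ 4 * (a + b * s ^ 2)) 0 (sqrt t)
       (minus (a * sqrt t ^ 5 / 5 + b * sqrt t ^ 7 / 7)
              (a * 0 ^ 5 / 5 + b * 0 ^ 7 / 7))).
    { apply (is_RInt_derive (fun s => a * s ^ 5 / 5 + b * s ^ 7 / 7)
              (fun s => s ^ 4 * (a + b * s ^ 2))).
      - intros x _. auto_derive; auto. field.
      - intros x _.
        apply (ex_derive_continuous (fun s : R => s ^ 4 * (a + b * s ^ 2))).
        auto_derive; auto. }
    rewrite (is_RInt_unique _ _ _ _ E).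
    unfold minus, plus, opp; simpl.
    assert (E2 : t = sqrt t * sqrt t) by (rewrite sqrt_sqrt; lra).
    set (r := sqrt t) in *. rewrite E2. field. lra.
Qed.

Lemma avg_const (M t : R) : 0 <= t -> avg (fun _ => M) t = M / 10.
Proof.
  intros t0. transitivity (avg (fun u => M + 0 * u) t).
  - unfold avg, radial_int. destruct (Rle_dec t 0); [lra|].
    f_equal. apply RInt_ext. intros x _. apply Rmult_eq_compat_l. ring.
  - rewrite avg_affine by easy. field.
Qed.

Lemma is_derive_avg (H : R -> R) (t : R) :
  (forall x, continuous H x) -> 0 < t ->
  is_derive (avg H) t ((H t - 10 * avg H t) / (4 * t)).
Proof.
  intros cH t0.
  assert (hs : 0 < sqrt t) by (apply sqrt_lt_R0; lra).
  apply (is_derive_ext_loc (fun u => radial_int H (sqrt u) / (2 * sqrt u ^ 5))).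
  { exists (mkposreal t t0). intros y hy. unfold avg.
    destruct (Rle_dec y 0) as [h|h]; [|easy].
    exfalso. apply Rabs_def2 in hy. unfold minus, plus, opp in hy; simpl in hy.
    lra. }
  assert (D : forall r, is_derive (radial_int H) r (r ^ 4 * H (r ^ 2))).
  { intros r. apply (is_derive_RInt_cont (fun s => s ^ 4 * H (s ^ 2))).
    apply continuous_radial, cH. }
  unfold avg. destruct (Rle_dec t 0) as [h|h]; [lra|].
  auto_derive.
  - repeat split; auto; try lra.
    + eexists; apply D.
    + apply Rgt_not_eq. apply Rmult_lt_0_compat; [lra|].
      apply (pow_lt _ 5); lra.
  - replace (Derive (fun x => radial_int H x) (sqrt t))
      with (sqrt t ^ 4 * H (sqrt t ^ 2))
      by (symmetry; apply is_derive_unique, D).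
    rewrite pow2_sqrt by lra.
    assert (E2 : t = sqrt t * sqrt t) by (rewrite sqrt_sqrt; lra).
    set (r := sqrt t) in *. set (X := H t). set (Y := radial_int H r).
    rewrite E2. simpl. field. lra.
Qed.

Lemma continuous_eps (f : R -> R) (x : R) :
  (forall eps, 0 < eps -> exists d, 0 < d /\
     forall y, Rabs (y - x) < d -> Rabs (f y - f x) <= eps) ->
  continuous f x.
Proof.
  intros h. apply continuity_pt_filterlim.
  intros eps he. destruct (h (eps / 2)) as [d [hd hd']]; [lra|].
  exists d. split; [easy|]. intros y [_ hy].
  apply Rle_lt_trans with (eps / 2); [apply hd', hy|lra].
Qed.

Lemma continuous_eps_inv (f : R -> R) (x : R) :
  continuous f x -> forall eps, 0 < eps -> exists d, 0 < d /\
     forall y, Rabs (y - x) < d -> Rabs (f y - f x) < eps.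
Proof.
  intros h eps he. apply continuity_pt_filterlim in h.
  destruct (h eps he) as [d [hd hd']].
  exists d. split; [easy|]. intros y hy.
  destruct (Req_dec y x) as [->|hn].
  - replace (f x - f x) with 0 by ring. rewrite Rabs_R0; easy.
  - apply hd'. repeat split; auto.
Qed.

Lemma continuous_avg (H : R -> R) (t : R) :
  (forall x, continuous H x) -> continuous (avg H) t.
Proof.
  intros cH. destruct (Rlt_le_dec 0 t) as [ht|ht].
  { apply (ex_derive_continuous (avg H)).
    eexists; apply is_derive_avg; auto. }
  apply continuous_eps. intros eps he.
  destruct (continuous_eps_inv H 0 (cH 0) eps he) as [d [hd hd']].
  exists d; split; [easy|]. intros y hy.
  assert (E : avg H t = H 0 / 10).
  { unfold avg. destruct (Rle_dec t 0); [easy|lra]. }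
  rewrite E. destruct (Rle_dec y 0) as [h|h].
  - unfold avg. destruct (Rle_dec y 0); [|lra].
    rewrite Rminus_diag, Rabs_R0; lra.
  - apply Rabs_def2 in hy.
    assert (B : forall u, 0 <= u <= y -> H 0 - eps <= H u <= H 0 + eps).
    { intros u hu. assert (A : Rabs (H u - H 0) < eps).
      { apply hd'. apply Rabs_def1; lra. }
      apply Rabs_def2 in A. lra. }
    assert (L : avg (fun _ => H 0 - eps) y <= avg H y).
    { apply avg_le; auto; try lra.
      - intros; apply continuous_const.
      - intros; apply B; easy. }
    assert (U : avg H y <= avg (fun _ => H 0 + eps) y).
    { apply avg_le; auto; try lra.
      - intros; apply continuous_const.
      - intros; apply B; easy. }
    rewrite avg_const in L, U by lra.
    apply Rabs_le. lra.
Qed.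

(** The derivative of [avg H] as dictated by its equation; [h0 / 14] is the slope at [0] found for
    affine functions of slope [h0]. *)
Definition avg' (H : R -> R) (h0 t : R) : R :=
  if Rle_dec t 0 then h0 / 14 else (H t - 10 * avg H t) / (4 * t).

Lemma continuous_avg' (H : R -> R) (h0 t : R) :
  (forall x, continuous H x) -> is_derive H 0 h0 -> continuous (avg' H h0) t.
Proof.
  intros cH dH. destruct (Rlt_le_dec 0 t) as [ht|ht].
  { apply (continuous_ext_loc (avg' H h0) (fun t => (H t - 10 * avg H t) / (4 * t))).
    { exists (mkposreal t ht). intros y hy. unfold avg'.
      destruct (Rle_dec y 0) as [h|h]; [|easy].
      exfalso. apply Rabs_def2 in hy. unfold minus, plus, opp in hy; simpl in hy.
      lra. }
    apply (continuous_mult (fun t => H t - 10 * avg H t) (fun t => / (4 * t))).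
    - apply (continuous_minus H (fun t => 10 * avg H t)); [apply cH|].
      apply (continuous_mult (fun _ => 10) (avg H)).
      + apply continuous_const.
      + apply continuous_avg, cH.
    - apply (ex_derive_continuous (fun t : R => / (4 * t))).
      auto_derive. lra. }
  apply continuous_eps. intros eps he.
  apply is_derive_Reals in dH. destruct (dH eps he) as [d hd].
  exists d; split; [apply cond_pos|]. intros y hy.
  assert (E : avg' H h0 t = h0 / 14).
  { unfold avg'. destruct (Rle_dec t 0); [easy|lra]. }
  rewrite E. destruct (Rle_dec y 0) as [h|h].
  - unfold avg'. destruct (Rle_dec y 0); [|lra].
    rewrite Rminus_diag, Rabs_R0; lra.
  - apply Rabs_def2 in hy.
    assert (B : forall u, 0 <= u <= y ->
      H 0 + (h0 - eps) * u <= H u <= H 0 + (h0 + eps) * u).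
    { intros u hu. destruct (Req_dec u 0) as [->|hn]; [lra|].
      assert (A : Rabs ((H (0 + u) - H 0) / u - h0) < eps).
      { apply hd; auto. apply Rabs_def1; lra. }
      rewrite Rplus_0_l in A.
      apply Rabs_def2 in A.
      assert (E' : H u - H 0 = (H u - H 0) / u * u) by (field; easy).
      nra. }
    assert (L : avg (fun u => H 0 + (h0 - eps) * u) y <= avg H y).
    { apply avg_le; auto; try lra.
      - intros. apply (ex_derive_continuous (fun u : R => H 0 + (h0 - eps) * u)).
        auto_derive; auto.
      - intros; apply B; easy. }
    assert (U : avg H y <= avg (fun u => H 0 + (h0 + eps) * u) y).
    { apply avg_le; auto; try lra.
      - intros. apply (ex_derive_continuous (fun u : R => H 0 + (h0 + eps) * u)).
        auto_derive; auto.
      - intros; apply B; easy. }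
    rewrite avg_affine in L, U by lra.
    assert (By := B y ltac:(lra)).
    unfold avg'. destruct (Rle_dec y 0); [lra|].
    set (W := H y - 10 * avg H y) in *.
    (* The error is [eps y] from [H y] and [10 eps y / 14] from [10 * avg H y], in total
       [24 / 14 eps y]; dividing by [4 y] leaves [6 / 14 eps]. *)
    assert (W1 : (h0 * 4 / 14 - eps * 24 / 14) * y <= W) by (unfold W; nra).
    assert (W2 : W <= (h0 * 4 / 14 + eps * 24 / 14) * y) by (unfold W; nra).
    assert (E' : W / (4 * y) * y * 4 = W) by (field; lra).
    apply Rabs_le. split; nra.
Qed.

(** * The linear boundary value problem *)

Definition weighted (mu : R) (h : R -> R) (u : R) : R := exp (mu * u) * h u.

(** Reduction of order: writing the unknown as [f = exp (mu t) z] turns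
    [4 t f'' + 10 f' = shift mu t f - h] into [4 t y' + 10 y = - exp (mu t) h] for
    [y = exp (2 mu t) z'], whence [y = - avg (weighted mu h)]. The second integration starts at [1]
    and imposes the value [1] there. *)
Definition sol (mu : R) (h : R -> R) (t : R) : R :=
  exp (mu * t) * (exp (- mu)
    - RInt (fun s => exp (- 2 * mu * s) * avg (weighted mu h) s) 1 t).

Definition sol' (mu : R) (h : R -> R) (t : R) : R :=
  mu * sol mu h t - exp (- mu * t) * avg (weighted mu h) t.

Definition shift (mu t : R) : R := 10 * mu + 4 * mu ^ 2 * t.

Lemma continuous_exp_lin (k x : R) : continuous (fun u => exp (k * u)) x.
Proof.
  apply (ex_derive_continuous (fun u : R => exp (k * u))). auto_derive; auto.
Qed.

Lemma continuous_weighted mu h :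
  (forall x, continuous h x) -> forall x, continuous (weighted mu h) x.
Proof.
  intros ch x. apply (continuous_mult (fun u => exp (mu * u)) h); [|apply ch].
  apply continuous_exp_lin.
Qed.

Lemma continuous_sol_integrand mu h :
  (forall x, continuous h x) -> forall x,
  continuous (fun s => exp (- 2 * mu * s) * avg (weighted mu h) s) x.
Proof.
  intros ch x.
  apply (continuous_mult (fun s => exp (- 2 * mu * s)) (avg (weighted mu h))).
  - apply continuous_exp_lin.
  - apply continuous_avg, continuous_weighted, ch.
Qed.

Lemma is_derive_sol mu h t :
  (forall x, continuous h x) -> is_derive (sol mu h) t (sol' mu h t).
Proof.
  intros ch.
  pose proof (is_derive_RInt_cont _ 1 t (continuous_sol_integrand mu h ch)) as D.
  unfold sol'.
  enough (E : forall f : R -> R,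
    is_derive f t (exp (- 2 * mu * t) * avg (weighted mu h) t) ->
    is_derive (fun t => exp (mu * t) * (exp (- mu) - f t)) t
      (mu * (exp (mu * t) * (exp (- mu) - f t))
       - exp (- mu * t) * avg (weighted mu h) t)) by exact (E _ D).
  clear D. intros f D. auto_derive.
  - repeat split; exists (exp (- 2 * mu * t) * avg (weighted mu h) t); apply D.
  - replace (Derive (fun x => f x) t) with (exp (- 2 * mu * t) * avg (weighted mu h) t)
      by (symmetry; apply is_derive_unique, D).
    replace (exp (- mu * t)) with (exp (mu * t) * exp (- 2 * mu * t)).
    + ring.
    + rewrite <- exp_plus. f_equal. ring.
Qed.

Lemma sol_1 mu h : sol mu h 1 = 1.
Proof.
  unfold sol. rewrite RInt_point. unfold zero; simpl.
  rewrite Rminus_0_r, <- exp_plus. replace (mu * 1 + - mu) with 0 by ring.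
  apply exp_0.
Qed.

Lemma is_derive_sol' mu h t :
  (forall x, continuous h x) -> 0 < t ->
  is_derive (sol' mu h) t
    ((shift mu t * sol mu h t - h t - 10 * sol' mu h t) / (4 * t)).
Proof.
  intros ch t0.
  pose proof (is_derive_sol mu h t ch) as D1.
  pose proof (is_derive_avg _ t (continuous_weighted mu h ch) t0) as D2.
  evar_last.
  { unfold sol' at 1.
    apply (is_derive_minus (fun t => mu * sol mu h t)
      (fun t => exp (- mu * t) * avg (weighted mu h) t)).
    - apply is_derive_scal, D1.
    - apply (is_derive_mult (fun t => exp (- mu * t)) (avg (weighted mu h))).
      + instantiate (1 := - mu * exp (- mu * t)). auto_derive; auto. ring.
      + apply D2.
      + intros; apply Rmult_comm. }
  unfold minus, plus, opp, mult; simpl.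
  unfold weighted at 2. unfold shift, sol'.
  set (w := avg (weighted mu h) t).
  assert (E : exp (mu * t) * exp (- mu * t) = 1).
  { rewrite <- exp_plus, <- exp_0. f_equal. ring. }
  set (p := exp (mu * t)) in *. set (q := exp (- mu * t)) in *.
  replace (h t) with (p * q * h t) at 2 by (rewrite E; ring).
  field. lra.
Qed.

(** At the singular point the equation degenerates to a first order relation, which replaces a
    boundary condition in the maximum principle. *)
Lemma sol'_0 mu h : 10 * sol' mu h 0 = shift mu 0 * sol mu h 0 - h 0.
Proof.
  unfold sol', shift, avg. destruct (Rle_dec 0 0); [|lra].
  unfold weighted. rewrite !Rmult_0_r, exp_0. field.
Qed.

Lemma continuous_sol mu h t :
  (forall x, continuous h x) -> continuous (sol mu h) t.
Proof.
  intros ch. apply (ex_derive_continuous (sol mu h)).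
  eexists; apply is_derive_sol, ch.
Qed.

Lemma continuous_sol' mu h t :
  (forall x, continuous h x) -> continuous (sol' mu h) t.
Proof.
  intros ch.
  apply (continuous_minus (fun t => mu * sol mu h t)
      (fun t => exp (- mu * t) * avg (weighted mu h) t)).
  - apply (continuous_mult (fun _ => mu) (sol mu h)).
    + apply continuous_const.
    + apply continuous_sol, ch.
  - apply (continuous_mult (fun t => exp (- mu * t)) (avg (weighted mu h))).
    + apply continuous_exp_lin.
    + apply continuous_avg, continuous_weighted, ch.
Qed.

Lemma weighted_avg_le mu h1 h2 t :
  (forall x, continuous h1 x) -> (forall x, continuous h2 x) ->
  (forall u, 0 <= u <= 1 -> h1 u <= h2 u) -> 0 <= t <= 1 ->
  avg (weighted mu h1) t <= avg (weighted mu h2) t.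
Proof.
  intros c1 c2 le ht. apply avg_le; try apply continuous_weighted; auto; try lra.
  intros u hu. apply Rmult_le_compat_l; [apply Rlt_le, exp_pos|].
  apply le; lra.
Qed.

(** The integral from [1] to [t] enters with a minus sign, so for [t <= 1] it contributes a positive
    integral over [[t, 1]], and [avg] is monotone. *)
Lemma sol_le mu h1 h2 t :
  (forall x, continuous h1 x) -> (forall x, continuous h2 x) ->
  (forall u, 0 <= u <= 1 -> h1 u <= h2 u) -> 0 <= t <= 1 ->
  sol mu h1 t <= sol mu h2 t.
Proof.
  intros c1 c2 le ht. unfold sol.
  apply Rmult_le_compat_l; [apply Rlt_le, exp_pos|].
  pose proof (continuous_sol_integrand mu h1 c1) as C1.
  pose proof (continuous_sol_integrand mu h2 c2) as C2.
  rewrite <- !(opp_RInt_swap (V := R_CompleteNormedModule) _ t 1)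
    by (apply ex_RInt_cont; auto).
  unfold opp; simpl.
  assert (A : RInt (fun s => exp (- 2 * mu * s) * avg (weighted mu h1) s) t 1 <=
              RInt (fun s => exp (- 2 * mu * s) * avg (weighted mu h2) s) t 1).
  { apply RInt_le; try lra; try (apply ex_RInt_cont; auto).
    intros x hx. apply Rmult_le_compat_l; [apply Rlt_le, exp_pos|].
    apply weighted_avg_le; auto; lra. }
  lra.
Qed.

Lemma weighted_avg_bounds mu h M t :
  (forall x, continuous h x) -> 0 <= mu ->
  (forall u, 0 <= u <= 1 -> 0 <= h u <= M) -> 0 <= t <= 1 ->
  0 <= avg (weighted mu h) t <= exp mu * M.
Proof.
  intros ch hmu B ht. pose proof (exp_pos mu) as pe.
  assert (M0 : 0 <= M) by (specialize (B 0); lra).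
  assert (P : 0 <= exp mu * M) by (apply Rmult_le_pos; lra).
  split.
  - replace 0 with (0 / 10) by field.
    rewrite <- (avg_const 0 t) by lra. apply avg_le; try lra.
    + intros; apply continuous_const.
    + apply continuous_weighted, ch.
    + intros u hu. apply Rmult_le_pos; [apply Rlt_le, exp_pos|].
      apply B; lra.
  - apply Rle_trans with (exp mu * M / 10); [|lra].
    rewrite <- (avg_const (exp mu * M) t) by lra. apply avg_le; try lra.
    + apply continuous_weighted, ch.
    + intros; apply continuous_const.
    + intros u hu. assert (Bu := B u ltac:(lra)).
      apply Rmult_le_compat; try lra; [apply Rlt_le, exp_pos|].
      destruct (Req_dec (mu * u) mu) as [->|]; [lra|].
      apply Rlt_le, exp_increasing. nra.
Qed.

(** A bound for the two terms of [sol'] that sees [h] only through [M], so that one constant serves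
    a whole family of right-hand sides. *)
Definition sol_lip (mu M : R) : R :=
  mu * (exp mu * (1 + exp mu * M)) + exp mu * M.

Lemma exp_le_1 (x : R) : x <= 0 -> exp x <= 1.
Proof.
  intros h. rewrite <- exp_0. destruct (Req_dec x 0) as [->|]; [lra|].
  apply Rlt_le, exp_increasing. lra.
Qed.

Lemma sol_bounds mu h M t :
  (forall x, continuous h x) -> 0 <= mu ->
  (forall u, 0 <= u <= 1 -> 0 <= h u <= M) -> 0 <= t <= 1 ->
  0 <= sol mu h t <= exp mu * (1 + exp mu * M).
Proof.
  intros ch hmu B ht. pose proof (exp_pos mu) as pe.
  unfold sol. pose proof (continuous_sol_integrand mu h ch) as C1.
  rewrite <- !(opp_RInt_swap (V := R_CompleteNormedModule) _ t 1)
    by (apply ex_RInt_cont; auto).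
  unfold opp; simpl.
  set (f := fun s => exp (- 2 * mu * s) * avg (weighted mu h) s).
  assert (Bf : forall x, t < x < 1 -> 0 <= f x <= exp mu * M).
  { intros x hx.
    assert (W := weighted_avg_bounds mu h M x ch hmu B ltac:(lra)).
    assert (E1 := exp_pos (- 2 * mu * x)).
    assert (E2 : exp (- 2 * mu * x) <= 1) by (apply exp_le_1; nra).
    unfold f. split; [apply Rmult_le_pos; lra|]. nra. }
  assert (I1 : 0 <= RInt f t 1).
  { apply RInt_ge_0; try lra.
    - apply ex_RInt_cont, C1.
    - apply Bf. }
  assert (I2 : RInt f t 1 <= RInt (fun _ => exp mu * M) t 1).
  { apply RInt_le; try lra.
    - apply ex_RInt_cont, C1.
    - apply ex_RInt_cont. intros; apply continuous_const.
    - intros; apply Bf; easy. }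
  rewrite RInt_const in I2. unfold scal in I2; simpl in I2.
  unfold mult in I2; simpl in I2.
  assert (M0 : 0 <= M) by (specialize (B 0); lra).
  assert (P : 0 <= exp mu * M) by (apply Rmult_le_pos; lra).
  assert (E1 := exp_pos (mu * t)). assert (E2 := exp_pos (- mu)).
  assert (E3 : exp (- mu) <= 1) by (apply exp_le_1; lra).
  assert (E4 : exp (mu * t) <= exp mu).
  { destruct (Req_dec (mu * t) mu) as [->|]; [lra|].
    apply Rlt_le, exp_increasing. nra. }
  replace (exp (- mu) - - RInt f t 1) with (exp (- mu) + RInt f t 1) by ring.
  split.
  - apply Rmult_le_pos; lra.
  - apply Rmult_le_compat; try lra. nra.
Qed.

Lemma sol'_bound mu h M t :
  (forall x, continuous h x) -> 0 <= mu ->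
  (forall u, 0 <= u <= 1 -> 0 <= h u <= M) -> 0 <= t <= 1 ->
  Rabs (sol' mu h t) <= sol_lip mu M.
Proof.
  intros ch hmu B ht.
  assert (W := weighted_avg_bounds mu h M t ch hmu B ht).
  assert (S := sol_bounds mu h M t ch hmu B ht).
  unfold sol', sol_lip.
  assert (E1 := exp_pos (- mu * t)).
  assert (E2 : exp (- mu * t) <= 1) by (apply exp_le_1; nra).
  apply Rabs_le. set (X := exp mu * (1 + exp mu * M)) in *.
  set (Y := exp mu * M) in *. nra.
Qed.

Lemma sol_lipschitz mu h M x y :
  (forall x, continuous h x) -> 0 <= mu ->
  (forall u, 0 <= u <= 1 -> 0 <= h u <= M) -> 0 <= x <= 1 -> 0 <= y <= 1 ->
  Rabs (sol mu h x - sol mu h y) <= sol_lip mu M * Rabs (x - y).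
Proof.
  intros ch hmu B hx hy.
  destruct (MVT_gen (sol mu h) y x (sol' mu h)) as [c [hc E]].
  - intros t _. apply is_derive_sol, ch.
  - intros t _. apply continuity_pt_filterlim, continuous_sol, ch.
  - rewrite E, Rabs_mult. apply Rmult_le_compat_r; [apply Rabs_pos|].
    apply sol'_bound; auto.
    revert hc. unfold Rmin, Rmax. destruct (Rle_dec y x); lra.
Qed.

(* At a positive maximum of [z] the first derivative vanishes, hence the second
   one is positive, which is absurd; a maximum at the left end point [a] is
   excluded by the sign of the first derivative. *)
Lemma max_principle (z z1 z2 : R -> R) (a b : R) :
  a < b ->
  (forall t, a <= t <= b -> is_derive z t (z1 t)) ->
  (forall t, a < t < b -> is_derive z1 t (z2 t)) ->
  (0 < z a -> continuous z1 a /\ 0 < z1 a) ->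
  z b <= 0 ->
  (forall t, a < t < b -> 0 < z t -> z1 t = 0 -> 0 < z2 t) ->
  forall t, a <= t <= b -> z t <= 0.
Proof.
  intros ab D1 D2 za zb pos.
  assert (Incr : forall p q, a <= p -> p < q -> q <= b ->
     (forall c, p < c < q -> 0 < z1 c) -> z p < z q).
  { intros p q ap pq qb hc.
    destruct (MVT_cor2 z z1 p q pq) as [c [E c']].
    - intros c cc. apply is_derive_Reals, D1. lra.
    - specialize (hc c c'). nra. }
  destruct (continuity_ab_maj z a b ltac:(lra)) as [m [hm mab]].
  { intros c hc. apply continuity_pt_filterlim.
    apply (ex_derive_continuous z). eexists; apply D1, hc. }
  intros t ht. apply Rle_trans with (z m); [apply hm, ht|].
  apply Rnot_lt_le. intros zm.
  destruct (Req_dec m b) as [->|mb]; [lra|].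
  assert (C : exists d, 0 < d /\ forall c, m < c < m + d -> c < b -> 0 < z1 c).
  { destruct (Req_dec m a) as [->|ma].
    - destruct (za zm) as [ca pa].
      destruct (continuous_eps_inv _ _ ca _ pa) as [d [d0 hd]].
      exists d; split; [easy|]. intros c hc _.
      assert (A : Rabs (z1 c - z1 a) < z1 a) by (apply hd, Rabs_def1; lra).
      apply Rabs_def2 in A. lra.
    - assert (Dm : derivable_pt_lim z m (z1 m)) by (apply is_derive_Reals, D1; lra).
      assert (z1m : z1 m = 0).
      { rewrite <- (derive_pt_eq_0 z m (z1 m) (exist _ _ Dm) Dm).
        apply (deriv_maximum z a b m); try lra.
        intros x h1 h2. apply hm; lra. }
      assert (p2 := pos m ltac:(lra) zm z1m).
      assert (Dm2 := D2 m ltac:(lra)). apply is_derive_Reals in Dm2.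
      destruct (Dm2 _ p2) as [d hd].
      exists d; split; [apply cond_pos|]. intros c hc _.
      assert (A := hd (c - m) ltac:(lra) ltac:(apply Rabs_def1; lra)).
      replace (m + (c - m)) with c in A by ring.
      rewrite z1m, Rminus_0_r in A.
      apply Rabs_def2 in A. destruct A as [_ A].
      assert (E : z1 c = z1 c / (c - m) * (c - m)) by (field; lra).
      nra. }
  destruct C as [d [d0 hd]].
  set (q := Rmin (m + d) b).
  assert (hq : m < q /\ q <= m + d /\ q <= b).
  { unfold q, Rmin. destruct (Rle_dec (m + d) b); lra. }
  assert (z m < z q).
  { apply Incr; try lra. intros c hc. apply hd; lra. }
  assert (z q <= z m) by (apply hm; lra). lra.
Qed.

(** The difference [z = sol - g] satisfies [4 t z'' + 10 z' >= shift z], so it has no positive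
    interior maximum. At [a = 0] this reads [10 z' >= shift z]: there [z] increases wherever it is
    positive, and no comparison of values is asked for. *)
Lemma sol_le_supersolution mu h (g g1 g2 : R -> R) (a b : R) :
  0 < mu -> (forall x, continuous h x) -> 0 <= a < b ->
  (forall t, a <= t <= b -> is_derive g t (g1 t)) ->
  (forall t, a <= t <= b -> is_derive g1 t (g2 t)) ->
  (forall t, a <= t <= b ->
     h t <= shift mu t * g t - (4 * t * g2 t + 10 * g1 t)) ->
  (a = 0 \/ sol mu h a <= g a) -> sol mu h b <= g b ->
  forall t, a <= t <= b -> sol mu h t <= g t.
Proof.
  intros hmu ch ab Dg Dg1 sup ha hb t ht.
  apply Rminus_le.
  apply (max_principle (fun t => sol mu h t - g t)
    (fun t => sol' mu h t - g1 t)
    (fun t => (shift mu t * sol mu h t - h t - 10 * sol' mu h t) / (4 * t) - g2 t)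
    a b); try lra.
  - intros u hu. apply (is_derive_minus (sol mu h) g).
    + apply is_derive_sol, ch.
    + apply Dg, hu.
  - intros u hu. apply (is_derive_minus (sol' mu h) g1).
    + apply is_derive_sol'; auto; lra.
    + apply Dg1; lra.
  - intros za. destruct ha as [ha|]; [|lra]. subst a. split.
    + apply (continuous_minus (sol' mu h) g1).
      * apply continuous_sol', ch.
      * apply (ex_derive_continuous g1). eexists; apply Dg1; lra.
    + assert (S := sup 0 ltac:(lra)). assert (E := sol'_0 mu h).
      unfold shift in *. nra.
  - intros u hu zu z1u. assert (S := sup u ltac:(lra)).
    set (W := shift mu u * sol mu h u - h u - 10 * sol' mu h u).
    assert (Ks : 0 < shift mu u) by (unfold shift; nra).
    assert (4 * u * g2 u < W) by (unfold W; nra).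
    assert (E : W / (4 * u) * (4 * u) = W) by (field; lra).
    nra.
Qed.

(** * The nonlinear radial system *)

Definition src_v (c t a s : R) : R := a ^ 2 * (3 - t * a) + c * s ^ 2 * (1 - t * a).
Definition src_s (lam t a s : R) : R :=
  2 * a * (2 - t * a) * s + lam / 2 * (1 - t * s ^ 2) * s.

(** First [s] is raised at fixed [a], which uses [1 - t a >= 0], then [a] at fixed [s']. In the
    second move [3 a^2] dominates the cubic term because [t a' <= 1], and [K >= c] outweighs the
    loss [c t s'^2 <= c]. *)
Lemma src_v_mono c K t a s a' s' :
  0 <= c <= K -> 0 <= t -> 0 <= a <= a' -> t * a' <= 1 -> 0 <= s <= s' ->
  t * s' ^ 2 <= 1 -> src_v c t a s + K * a <= src_v c t a' s' + K * a'.
Proof.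
  intros hc ht ha ta hs ts. unfold src_v.
  assert (t * a <= t * a') by nra.
  assert (S1 : c * s ^ 2 * (1 - t * a) <= c * s' ^ 2 * (1 - t * a)).
  { apply Rmult_le_compat_r; [lra|]. apply Rmult_le_compat_l; [lra|].
    apply pow_incr; lra. }
  assert (S2 : 0 <= (a' - a) * (3 * (a + a') - (t * a) * a - (t * a') * a
     - (t * a') * a' - c * (t * s' ^ 2) + K)).
  { apply Rmult_le_pos; [lra|].
    assert (c * (t * s' ^ 2) <= c) by nra.
    assert ((t * a) * a <= a) by nra. assert ((t * a') * a <= a) by nra.
    assert ((t * a') * a' <= a') by nra. nra. }
  nra.
Qed.

(** Raising [a] is harmless because [2 - t a - t a' >= 0]. Raising [s], the difference quotient of
    [s - t s^3] is at least [1 - 3 = - 2]; times [lam / 2] this loses at most [lam <= K]. *)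
Lemma src_s_mono lam K t a s a' s' :
  0 <= lam <= K -> 0 <= t -> 0 <= a <= a' -> t * a' <= 1 -> 0 <= s <= s' ->
  t * s' ^ 2 <= 1 -> src_s lam t a s + K * s <= src_s lam t a' s' + K * s'.
Proof.
  intros hc ht ha ta hs ts. unfold src_s.
  assert (t * a <= t * a') by nra.
  assert (S1 : 0 <= s * ((a' - a) * (2 - t * a - t * a'))).
  { apply Rmult_le_pos; [lra|]. apply Rmult_le_pos; lra. }
  assert (s ^ 2 <= s' ^ 2) by (apply pow_incr; lra).
  assert (s * s' <= s' ^ 2) by nra.
  assert (S2 : 0 <= (s' - s) * (2 * a' * (2 - t * a')
     + lam / 2 * (1 - t * s ^ 2 - t * (s * s') - t * s' ^ 2) + K)).
  { apply Rmult_le_pos; [lra|].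
    assert (0 <= a' * (2 - t * a')) by (apply Rmult_le_pos; lra).
    assert (t * s ^ 2 <= 1) by nra. assert (t * (s * s') <= 1) by nra.
    nra. }
  nra.
Qed.

(** With [B = cap_v] and [C = cap_s], three demands fix the constants: [C = 4 B + lam] dominates the
    coefficient of [s] in its source, [4 c C <= B^2] absorbs the coupling term of the [v]-equation
    (hence [16 c]), and [B >= 2] puts the points [2 / B] and [1 / C], where the regular barriers
    meet the singular ones, inside [[0, 1]]. *)
Definition cap_v (c lam : R) : R := 16 * c + lam + 2.
Definition cap_s (c lam : R) : R := 4 * cap_v c lam + lam.

(* The last bound in each line is the singular exact solution
   [a = 1 / t, s = 1 / sqrt t]; the one before it keeps the pair bounded near
   [t = 0]. *)
Definition region (c lam t a s : R) : Prop :=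
  (0 <= a /\ a * (1 + cap_v c lam * t / 2) <= cap_v c lam /\ t * a <= 1) /\
  (0 <= s /\ sqrt (1 + cap_s c lam * t) * s <= sqrt (2 * cap_s c lam) /\
   sqrt t * s <= 1).

Section System.

Context (c lam : R) (hc : 0 < c) (hlam : 0 <= lam).

Let mu := c + lam.
Let B := cap_v c lam.
Let C := cap_s c lam.

Lemma cap_v_ge : 2 <= B.
Proof using hc hlam. unfold B, cap_v; lra. Qed.

Lemma cap_s_ge : 8 <= C.
Proof using hc hlam. unfold C, cap_s. pose proof cap_v_ge. unfold B in *. lra. Qed.

Lemma cap_v_sq : 4 * c * C <= B ^ 2.
Proof using hc hlam. unfold B, C, cap_s, cap_v. nra. Qed.

Lemma region_bounds t a s : 0 <= t <= 1 -> region c lam t a s ->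
  0 <= a <= B /\ 0 <= s <= sqrt (2 * C) /\ t * a <= 1 /\ t * s ^ 2 <= 1.
Proof using hc hlam.
  pose proof cap_v_ge. pose proof cap_s_ge.
  intros ht [[a0 [a1 a2]] [s0 [s1 s2]]]. fold B in a1. fold C in s1.
  assert (1 <= sqrt (1 + C * t)).
  { rewrite <- sqrt_1 at 1. apply sqrt_le_1; nra. }
  assert (0 <= sqrt t) by apply sqrt_pos.
  repeat split; auto.
  - assert (0 <= B * t / 2) by nra. nra.
  - nra.
  - rewrite <- (pow2_sqrt t) by lra. rewrite <- Rpow_mult_distr.
    rewrite <- (pow1 2). apply pow_incr. nra.
Qed.

(** Only [[0, 1]] matters, but the lemmas on [sol] want continuity on the whole line; composing with
    a 1-Lipschitz retraction provides it and preserves Lipschitz constants. *)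
Definition clip (t : R) : R := Rmax 0 (Rmin t 1).

Lemma clip_range t : 0 <= clip t <= 1.
Proof using.
  unfold clip, Rmax, Rmin.
  destruct (Rle_dec t 1); destruct (Rle_dec 0 _); lra.
Qed.

Lemma clip_id t : 0 <= t <= 1 -> clip t = t.
Proof using.
  intros h. unfold clip, Rmax, Rmin.
  destruct (Rle_dec t 1); destruct (Rle_dec 0 _); lra.
Qed.

Lemma clip_lip x y : Rabs (clip x - clip y) <= Rabs (x - y).
Proof using.
  unfold clip, Rmax, Rmin, Rabs.
  destruct (Rle_dec x 1); destruct (Rle_dec y 1);
  repeat destruct (Rle_dec 0 _); repeat destruct (Rcase_abs _); lra.
Qed.

Definition lipschitz (L : R) (f : R -> R) : Prop :=
  forall x y, Rabs (f x - f y) <= L * Rabs (x - y).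

Lemma lipschitz_continuous L f x : lipschitz L f -> continuous f x.
Proof using.
  intros hf. apply continuous_eps. intros eps he.
  assert (L0 := Rabs_pos L).
  exists (eps / (Rabs L + 1)). split; [apply Rdiv_lt_0_compat; lra|].
  intros y hy. apply Rle_trans with (L * Rabs (y - x)); [apply hf|].
  assert (P := Rabs_pos (y - x)). assert (L <= Rabs L) by apply Rle_abs.
  assert (E : eps / (Rabs L + 1) * (Rabs L + 1) = eps) by (field; lra).
  nra.
Qed.

(** For each member, [f x <= f y + L |x - y| <= g y + L |x - y|]; taking the supremum on the left
    and exchanging [x] and [y] gives the constant of [g]. This is the order completeness that
    Tarski's argument needs, without leaving the continuous functions. *)
Lemma lipschitz_sup (F : (R -> R) -> Prop) (L : R) :
  (exists f, F f) -> (forall f, F f -> lipschitz L f) ->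
  (forall t, exists b, forall f, F f -> f t <= b) ->
  exists g, lipschitz L g /\ (forall f t, F f -> f t <= g t) /\
    forall t b, (forall f, F f -> f t <= b) -> g t <= b.
Proof using.
  intros [f0 hf0] lip bnd.
  set (E := fun t y => exists f, F f /\ y = f t).
  assert (Eb : forall t, bound (E t)).
  { intros t. destruct (bnd t) as [b hb]. exists b. intros y [f [hf ->]].
    apply hb, hf. }
  assert (Ei : forall t, exists y, E t y).
  { intros t. exists (f0 t), f0. auto. }
  set (g := fun t => proj1_sig (completeness (E t) (Eb t) (Ei t))).
  assert (ub : forall f t, F f -> f t <= g t).
  { intros f t hf. unfold g. destruct (completeness _ _ _) as [m [h1 h2]]; simpl.
    apply h1. exists f; auto. }
  assert (lub : forall t b, (forall f, F f -> f t <= b) -> g t <= b).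
  { intros t b hb. unfold g. destruct (completeness _ _ _) as [m [h1 h2]]; simpl.
    apply h2. intros y [f [hf ->]]. apply hb, hf. }
  assert (half : forall x y, g x <= g y + L * Rabs (x - y)).
  { intros x y. apply lub. intros f hf.
    assert (A := lip f hf x y). assert (A2 := ub f y hf).
    assert (A3 := Rle_abs (f x - f y)). lra. }
  exists g. split; [|split]; auto.
  intros x y. assert (h1 := half x y). assert (h2 := half y x).
  rewrite (Rabs_minus_sym y x) in h2. apply Rabs_le. lra.
Qed.

Definition rhs_v (a s : R -> R) (t : R) : R :=
  src_v c (clip t) (a (clip t)) (s (clip t)) + shift mu (clip t) * a (clip t).
Definition rhs_s (a s : R -> R) (t : R) : R :=
  src_s lam (clip t) (a (clip t)) (s (clip t)) + shift mu (clip t) * s (clip t).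

Definition step_v (a s : R -> R) (t : R) : R := sol mu (rhs_v a s) (clip t).
Definition step_s (a s : R -> R) (t : R) : R := sol mu (rhs_s a s) (clip t).

(** The bounds for both sources and both shift terms are added up, so that a single number bounds
    [rhs_v] and [rhs_s] alike. *)
Definition rhs_max : R :=
  3 * B ^ 2 + c * sqrt (2 * C) ^ 2 + 4 * B * sqrt (2 * C)
  + lam / 2 * sqrt (2 * C)
  + (10 * mu + 4 * mu ^ 2) * (B + sqrt (2 * C)).

Definition lip_const : R := sol_lip mu rhs_max.

(** The Lipschitz constant is the one that the linear solution operator produces from any pair in
    the region, so the iteration can preserve it. *)
Definition admissible (a s : R -> R) : Prop :=
  lipschitz lip_const a /\ lipschitz lip_const s /\
  forall t, 0 <= t <= 1 -> region c lam t (a t) (s t).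

Ltac cont_poly :=
  repeat first [ assumption | apply continuity_pt_const; intros ? ?; reflexivity |
  match goal with
  | |- continuity_pt (fun t => @?f t + @?g t) _ => apply (continuity_pt_plus f g)
  | |- continuity_pt (fun t => @?f t - @?g t) _ => apply (continuity_pt_minus f g)
  | |- continuity_pt (fun t => @?f t * @?g t) _ => apply (continuity_pt_mult f g)
  | |- continuity_pt (fun t => @?f t ^ 2) ?x =>
      change (continuity_pt (fun t => f t * (f t * 1)) x)
  end ].

Lemma continuous_rhs a s :
  (forall x, continuous a x) -> (forall x, continuous s x) ->
  forall x, continuous (rhs_v a s) x /\ continuous (rhs_s a s) x.
Proof using.
  intros ca cs x.
  assert (cc : continuous clip x).
  { apply (lipschitz_continuous 1). intros u w. rewrite Rmult_1_l. apply clip_lip. }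
  assert (ca' : continuous (fun t => a (clip t)) x)
    by (apply (continuous_comp clip a); auto).
  assert (cs' : continuous (fun t => s (clip t)) x)
    by (apply (continuous_comp clip s); auto).
  apply continuity_pt_filterlim in cc.
  apply continuity_pt_filterlim in ca'.
  apply continuity_pt_filterlim in cs'.
  split; apply continuity_pt_filterlim; unfold rhs_v, rhs_s, src_v, src_s, shift.
  - cont_poly.
  - cont_poly.
Qed.

Lemma shift_ge t : 0 <= t -> c <= shift mu t /\ lam <= shift mu t.
Proof using hc hlam.
  intros ht. unfold shift, mu.
  assert (0 <= (c + lam) ^ 2 * t) by (apply Rmult_le_pos; [apply pow2_ge_0|lra]).
  split; nra.
Qed.

Lemma mu_pos : 0 < mu.
Proof using hc hlam. unfold mu; lra. Qed.

Lemma src_v_bounds t a s : 0 <= t <= 1 -> region c lam t a s ->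
  0 <= src_v c t a s <= 3 * B ^ 2 + c * sqrt (2 * C) ^ 2.
Proof using hc hlam.
  intros ht r. destruct (region_bounds t a s ht r) as [ha [hs [ta ts]]].
  unfold src_v. assert (0 <= t * a) by nra.
  assert (a ^ 2 <= B ^ 2) by (apply pow_incr; lra).
  assert (s ^ 2 <= sqrt (2 * C) ^ 2) by (apply pow_incr; lra).
  assert (0 <= a ^ 2) by apply pow2_ge_0.
  assert (0 <= s ^ 2) by apply pow2_ge_0.
  assert (0 <= c * s ^ 2) by nra.
  assert (c * s ^ 2 <= c * sqrt (2 * C) ^ 2) by nra.
  split; nra.
Qed.

Lemma src_s_bounds t a s : 0 <= t <= 1 -> region c lam t a s ->
  0 <= src_s lam t a s <= 4 * B * sqrt (2 * C) + lam / 2 * sqrt (2 * C).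
Proof using hc hlam.
  intros ht r. destruct (region_bounds t a s ht r) as [ha [hs [ta ts]]].
  unfold src_s. assert (0 <= t * a) by nra.
  assert (0 <= t * s ^ 2) by (apply Rmult_le_pos; [lra|apply pow2_ge_0]).
  assert (0 <= 2 * a * (2 - t * a) <= 4 * B) by (split; nra).
  assert (0 <= lam / 2 * (1 - t * s ^ 2) <= lam / 2) by (split; nra).
  split.
  - nra.
  - apply Rplus_le_compat; apply Rmult_le_compat; lra.
Qed.

Lemma rhs_bounds a s t : admissible a s ->
  0 <= rhs_v a s t <= rhs_max /\ 0 <= rhs_s a s t <= rhs_max.
Proof using hc hlam.
  intros [_ [_ r]]. unfold rhs_v, rhs_s, rhs_max.
  pose proof (clip_range t) as ht. specialize (r _ ht).
  set (u := clip t) in *.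
  pose proof (src_v_bounds _ _ _ ht r) as b1.
  pose proof (src_s_bounds _ _ _ ht r) as b2.
  destruct (region_bounds _ _ _ ht r) as [ha [hs _]].
  assert (0 <= shift mu u <= 10 * mu + 4 * mu ^ 2).
  { pose proof mu_pos. unfold shift. split; nra. }
  pose proof cap_v_ge. pose proof (sqrt_pos (2 * C)).
  assert (0 <= shift mu u * a u <= (10 * mu + 4 * mu ^ 2) * B) by (split; nra).
  assert (0 <= shift mu u * s u <= (10 * mu + 4 * mu ^ 2) * sqrt (2 * C))
    by (split; nra).
  lra.
Qed.

Lemma admissible_continuous a s : admissible a s ->
  (forall x, continuous (rhs_v a s) x) /\ (forall x, continuous (rhs_s a s) x).
Proof using.
  intros [la [ls _]].
  split; intros x; apply continuous_rhs;
    intros y; apply (lipschitz_continuous lip_const); auto.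
Qed.

Lemma step_lipschitz a s : admissible a s ->
  lipschitz lip_const (step_v a s) /\ lipschitz lip_const (step_s a s).
Proof using hc hlam.
  intros adm. destruct (admissible_continuous a s adm) as [cv cs].
  pose proof mu_pos as hmu.
  pose proof (fun t => rhs_bounds a s t adm) as bd.
  assert (L0 : 0 <= lip_const).
  { apply Rle_trans with (Rabs (sol' mu (rhs_v a s) 0)); [apply Rabs_pos|].
    apply sol'_bound; try lra; auto. intros; apply bd. }
  split; intros x y.
  - apply Rle_trans with (lip_const * Rabs (clip x - clip y)).
    + apply sol_lipschitz; try lra; auto; try apply clip_range.
      intros; apply bd.
    + apply Rmult_le_compat_l; [easy|apply clip_lip].
  - apply Rle_trans with (lip_const * Rabs (clip x - clip y)).
    + apply sol_lipschitz; try lra; auto; try apply clip_range.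
      intros; apply bd.
    + apply Rmult_le_compat_l; [easy|apply clip_lip].
Qed.

(** By [shift_ge], [shift mu t] may serve as the [K] of [src_v_mono]. Freezing the source at the
    value [a'] of a barrier is what turns a supersolution of the nonlinear equation into one of the
    linear problem. *)
Lemma rhs_v_le a s t a' : admissible a s -> 0 <= t <= 1 ->
  a t <= a' -> t * a' <= 1 ->
  rhs_v a s t <= shift mu t * a' + src_v c t a' (s t).
Proof using hc hlam.
  intros [_ [_ r]] ht le ta. unfold rhs_v. rewrite clip_id by easy.
  destruct (region_bounds _ _ _ ht (r t ht)) as [ha [hs [h1 h2]]].
  destruct (shift_ge t ltac:(lra)) as [k1 k2].
  rewrite (Rplus_comm (shift mu t * a')).
  apply src_v_mono; lra.
Qed.

Lemma rhs_s_le a s t a' s' : admissible a s -> 0 <= t <= 1 ->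
  a t <= a' -> t * a' <= 1 -> s t <= s' -> t * s' ^ 2 <= 1 ->
  rhs_s a s t <= shift mu t * s' + src_s lam t a' s'.
Proof using hc hlam.
  intros [_ [_ r]] ht le ta le' ts. unfold rhs_s. rewrite clip_id by easy.
  destruct (region_bounds _ _ _ ht (r t ht)) as [ha [hs [h1 h2]]].
  destruct (shift_ge t ltac:(lra)) as [k1 k2].
  rewrite (Rplus_comm (shift mu t * s')).
  apply src_s_mono; lra.
Qed.

(** A crude bound, but finite at [t = 0]: it starts the comparison with the singular solution, which
    is infinite there. *)
Lemma step_sol_bounds a s : admissible a s -> exists X, 0 < X /\
  forall t, 0 <= t <= 1 -> 0 <= sol mu (rhs_v a s) t <= X /\
    0 <= sol mu (rhs_s a s) t <= X.
Proof using hc hlam.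
  intros adm. destruct (admissible_continuous a s adm) as [cv cs].
  pose proof mu_pos as hmu.
  pose proof (fun t => rhs_bounds a s t adm) as bd.
  exists (exp mu * (1 + exp mu * rhs_max)). split.
  - assert (M0 := bd 0). pose proof (exp_pos mu).
    apply Rmult_lt_0_compat; [lra|].
    assert (0 <= exp mu * rhs_max) by (apply Rmult_le_pos; lra). lra.
  - intros t ht. split; apply sol_bounds; try lra; auto; intros; apply bd.
Qed.

(** The function [1 / t] solves the [v]-equation whatever [s] is, because the coupling term carries
    the factor [1 - t v]. It is undefined at [0], so the comparison runs on some [[e, 1]]. *)
Lemma step_v_singular_bound a s t : admissible a s -> 0 <= t <= 1 ->
  t * sol mu (rhs_v a s) t <= 1.
Proof using hc hlam.
  intros adm ht. destruct (Req_dec t 0) as [->|tn]; [lra|].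
  destruct (admissible_continuous a s adm) as [cv cs].
  destruct (step_sol_bounds a s adm) as [X [X0 hX]].
  (* [e <= / (X + 1)] makes the solution at most [X <= / e] at the left end; [e <= t] keeps [t] in
     the interval. *)
  set (e := Rmin t (/ (X + 1))).
  assert (i0 : 0 < / (X + 1)) by (apply Rinv_0_lt_compat; lra).
  assert (i1 : / (X + 1) * (X + 1) = 1) by (field; lra).
  assert (he : 0 < e /\ e <= t /\ e <= / (X + 1)).
  { unfold e, Rmin. destruct (Rle_dec _ _); lra. }
  assert (e1 : e < 1) by nra.
  assert (A : sol mu (rhs_v a s) t <= / t).
  { apply (sol_le_supersolution mu (rhs_v a s) (fun t => / t)
      (fun t => - / t ^ 2) (fun t => 2 / t ^ 3) e 1); auto; try lra.
    - apply mu_pos.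
    - intros u hu. auto_derive; [lra|]. field. lra.
    - intros u hu. auto_derive; [nra|]. field. lra.
    - intros u hu.
      assert (iu : 0 < / u) by (apply Rinv_0_lt_compat; lra).
      assert (uu : u * / u = 1) by (field; lra).
      pose proof adm as [la [ls r]].
      destruct (region_bounds u (a u) (s u) ltac:(lra) (r u ltac:(lra))) as [ha [hs [h1 h2]]].
      apply Rle_trans with (shift mu u * / u + src_v c u (/ u) (s u)).
      + apply rhs_v_le; try assumption; try lra.
        replace (a u) with (u * a u * / u) by (field; lra). nra.
      + apply Rplus_le_compat_l. apply Req_le. unfold src_v. field. lra.
    - right. destruct (hX e ltac:(lra)) as [[_ b] _].
      assert (ie : 0 < / e) by (apply Rinv_0_lt_compat; lra).
      assert (ee : e * / e = 1) by (field; lra). nra.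
    - rewrite sol_1. lra. }
  assert (tt : t * / t = 1) by (field; lra).
  nra.
Qed.

(** The function [1 / sqrt t] solves the [s]-equation when [v = 1 / t], and cooperativity allows
    raising [a] to [1 / t] in the source. *)
Lemma step_s_singular_bound a s t : admissible a s -> 0 <= t <= 1 ->
  sqrt t * sol mu (rhs_s a s) t <= 1.
Proof using hc hlam.
  intros adm ht. destruct (Req_dec t 0) as [->|tn]; [rewrite sqrt_0; lra|].
  destruct (admissible_continuous a s adm) as [cv cs].
  destruct (step_sol_bounds a s adm) as [X [X0 hX]].
  (* The square is there because the left end now requires [X <= / sqrt e]. *)
  set (e := Rmin t ((/ (X + 1)) ^ 2)).
  assert (i0 : 0 < / (X + 1)) by (apply Rinv_0_lt_compat; lra).
  assert (i1 : / (X + 1) * (X + 1) = 1) by (field; lra).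
  assert (he : 0 < e /\ e <= t /\ e <= (/ (X + 1)) ^ 2).
  { unfold e, Rmin. destruct (Rle_dec _ _); nra. }
  assert (e1 : e < 1) by nra.
  assert (st : forall u, 0 < u -> 0 < sqrt u /\ sqrt u * sqrt u = u
            /\ 0 < / sqrt u /\ sqrt u * / sqrt u = 1).
  { intros u hu. assert (0 < sqrt u) by (apply sqrt_lt_R0; lra).
    repeat split; auto.
    - apply sqrt_sqrt; lra.
    - apply Rinv_0_lt_compat; auto.
    - field; lra. }
  assert (A : sol mu (rhs_s a s) t <= / sqrt t).
  { apply (sol_le_supersolution mu (rhs_s a s) (fun t => / sqrt t)
      (fun t => - / 2 * / sqrt t ^ 3) (fun t => 3 / 4 * / sqrt t ^ 5) e 1);
      auto; try lra.
    - apply mu_pos.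
    - intros u hu. destruct (st u ltac:(lra)) as [q0 [q1 [q2 q3]]].
      auto_derive; [split; lra|]. field. lra.
    - intros u hu. destruct (st u ltac:(lra)) as [q0 [q1 [q2 q3]]].
      auto_derive; [repeat split; try lra; apply Rgt_not_eq; apply (pow_lt _ 3 q0)|].
      field. lra.
    - intros u hu. destruct (st u ltac:(lra)) as [q0 [q1 [q2 q3]]].
      assert (iu : 0 < / u) by (apply Rinv_0_lt_compat; lra).
      assert (uu : u * / u = 1) by (field; lra).
      pose proof adm as [la [ls r]].
      destruct (region_bounds u (a u) (s u) ltac:(lra) (r u ltac:(lra))) as [ha [hs [h1 h2]]].
      destruct (r u ltac:(lra)) as [_ [_ [_ h3]]].
      apply Rle_trans with (shift mu u * / sqrt u + src_s lam u (/ u) (/ sqrt u)).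
      + apply rhs_s_le; try assumption; try lra.
        * replace (a u) with (u * a u * / u) by (field; lra). nra.
        * replace (s u) with (sqrt u * s u * / sqrt u) by (field; lra). nra.
        * rewrite <- q1 at 1. apply Req_le. field. lra.
      + apply Rplus_le_compat_l. apply Req_le. unfold src_s.
        set (q := sqrt u) in *. clearbody q. subst u. field. lra.
    - right. destruct (hX e ltac:(lra)) as [_ [_ b]].
      destruct (st e ltac:(lra)) as [q0 [q1 [q2 q3]]].
      assert (sqrt e <= / (X + 1)).
      { rewrite <- (sqrt_pow2 (/ (X + 1))) by lra. apply sqrt_le_1; lra. }
      nra.
    - rewrite sol_1, sqrt_1. lra. }
  destruct (st t ltac:(lra)) as [q0 [q1 [q2 q3]]].
  nra.
Qed.

(** The barrier is [B / (1 + B t / 2) = 2 / (t + 2 / B)], which crosses [1 / t] at [t = 2 / B]. To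
    the left it stays in the cooperative range [t g <= 1], so the comparison applies; to the right
    the singular bound already implies the claim. *)
Lemma step_v_regular_bound a s t : admissible a s -> 0 <= t <= 1 ->
  sol mu (rhs_v a s) t * (1 + B * t / 2) <= B.
Proof using hc hlam.
  intros adm ht. pose proof cap_v_ge as hB. pose proof cap_s_ge as hC.
  destruct (admissible_continuous a s adm) as [cv cs].
  destruct (step_sol_bounds a s adm) as [X [X0 hX]].
  assert (iB : 0 < 2 / B) by (apply Rdiv_lt_0_compat; lra).
  assert (iB' : 2 / B * B = 2) by (field; lra).
  assert (iB1 : 2 / B <= 1) by nra.
  destruct (Rle_lt_dec t (2 / B)) as [tB|tB].
  - assert (pos : forall u, 0 <= u -> 0 < 1 + B * u / 2) by (intros; nra).
    assert (A : sol mu (rhs_v a s) t <= B / (1 + B * t / 2)).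
    { apply (sol_le_supersolution mu (rhs_v a s) (fun t => B / (1 + B * t / 2))
        (fun t => - B ^ 2 / 2 / (1 + B * t / 2) ^ 2)
        (fun t => B ^ 3 / 2 / (1 + B * t / 2) ^ 3) 0 (2 / B)); auto; try lra.
      - apply mu_pos.
      - intros u hu. assert (p := pos u ltac:(lra)).
        auto_derive; [lra|]. field. lra.
      - intros u hu. assert (p := pos u ltac:(lra)).
        auto_derive; [nra|]. field. lra.
      - intros u hu. assert (p := pos u ltac:(lra)).
        pose proof adm as [la [ls r]].
        destruct (region_bounds u (a u) (s u) ltac:(lra) (r u ltac:(lra)))
          as [ha [hs [h1 h2]]].
        destruct (r u ltac:(lra)) as [[_ [h3 _]] _]. fold B in h3.
        set (y := / (1 + B * u / 2)).
        assert (y0 : 0 < y) by (apply Rinv_0_lt_compat; lra).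
        assert (y1 : y * (1 + B * u / 2) = 1) by (unfold y; field; lra).
        assert (uB : u * B <= 2) by nra.
        assert (uB0 : 0 <= u * B) by nra.
        assert (y2 : 1 / 2 <= y) by nra.
        apply Rle_trans with
          (shift mu u * (B * y) + src_v c u (B * y) (s u)).
        + apply rhs_v_le; try assumption; try lra.
          replace (a u) with (y * (a u * (1 + B * u / 2)))
            by (rewrite (Rmult_comm (a u)), <- Rmult_assoc, y1; ring).
          nra.
        + unfold Rdiv at 1. fold y.
          unfold Rminus. apply Rplus_le_compat_l.
          replace (B ^ 3 / 2 / (1 + B * u / 2) ^ 3) with (B ^ 3 / 2 * y ^ 3)
            by (unfold y; field; lra).
          replace (- B ^ 2 / 2 / (1 + B * u / 2) ^ 2) with (- B ^ 2 / 2 * y ^ 2)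
            by (unfold y; field; lra).
          (* With this identity the supersolution inequality reduces to
             [c s^2 (2 y - 1) <= 2 B^2 y^3], and [cap_v_sq] bounds the left side by
             [B^2 / 2 (2 y - 1)]. *)
          assert (E : u * (B * y) = 2 - 2 * y) by lra.
          replace (- (4 * u * (B ^ 3 / 2 * y ^ 3) + 10 * (- B ^ 2 / 2 * y ^ 2)))
            with (5 * B ^ 2 * y ^ 2 - 2 * (u * (B * y)) * (B ^ 2 * y ^ 2)) by field.
          unfold src_v. rewrite E.
          assert (s2 : s u ^ 2 <= 2 * C).
          { rewrite <- (pow2_sqrt (2 * C)) by lra. apply pow_incr; lra. }
          assert (Q := cap_v_sq).
          assert (c * s u ^ 2 * (2 * y - 1) <= c * (2 * C) * (2 * y - 1)).
          { apply Rmult_le_compat_r; [lra|]. apply Rmult_le_compat_l; lra. }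
          assert (c * (2 * C) * (2 * y - 1) <= B ^ 2 / 2 * (2 * y - 1)).
          { apply Rmult_le_compat_r; lra. }
          assert (y <= 1) by nra.
          (* The product below expands to [4 y^3 - 3 y + 1], and [3 y - 1 >= 2 y - 1]. *)
          assert (2 * y - 1 <= 4 * y ^ 3).
          { assert (0 <= (2 * y - 1) ^ 2 * (y + 1)) by
              (apply Rmult_le_pos; [apply pow2_ge_0|lra]). nra. }
          assert (0 <= B ^ 2) by apply pow2_ge_0.
          assert (B ^ 2 / 2 * (2 * y - 1) <= B ^ 2 / 2 * (4 * y ^ 3))
            by (apply Rmult_le_compat_l; lra).
          nra.
      (* At the crossing point the barrier equals [B / 2], which is exactly the singular bound. *)
      - assert (S := step_v_singular_bound a s (2 / B) adm ltac:(lra)).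
        replace (1 + B * (2 / B) / 2) with 2 by (field; lra).
        nra. }
    assert (p := pos t ltac:(lra)).
    assert (E : B / (1 + B * t / 2) * (1 + B * t / 2) = B) by (field; lra).
    nra.
  - assert (S := step_v_singular_bound a s t adm ht).
    destruct (hX t ht) as [[u0 _] _].
    set (u := sol mu (rhs_v a s) t) in *.
    assert (2 < t * B) by nra.
    assert (u <= B / 2) by nra. nra.
Qed.

(** The square of the barrier is [2 / (t + 1 / C)], which crosses [1 / t] at [t = 1 / C]; the same
    division into two cases applies, since [t g^2 <= 1] holds only up to that point. *)
Lemma step_s_regular_bound a s t : admissible a s -> 0 <= t <= 1 ->
  sqrt (1 + C * t) * sol mu (rhs_s a s) t <= sqrt (2 * C).
Proof using hc hlam.
  intros adm ht. pose proof cap_v_ge as hB. pose proof cap_s_ge as hC.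
  destruct (admissible_continuous a s adm) as [cv cs].
  destruct (step_sol_bounds a s adm) as [X [X0 hX]].
  assert (iC : 0 < / C) by (apply Rinv_0_lt_compat; lra).
  assert (iC' : / C * C = 1) by (field; lra).
  assert (iC1 : / C <= 1) by nra.
  set (m := sqrt (2 * C)).
  assert (m0 : 0 < m) by (apply sqrt_lt_R0; lra).
  assert (mm : m * m = 2 * C) by (apply sqrt_sqrt; lra).
  assert (st : forall u, 0 <= u -> 0 < sqrt (1 + C * u) /\
    sqrt (1 + C * u) * sqrt (1 + C * u) = 1 + C * u).
  { intros u hu. split; [apply sqrt_lt_R0; nra|apply sqrt_sqrt; nra]. }
  destruct (Rle_lt_dec t (/ C)) as [tC|tC].
  - assert (A : sol mu (rhs_s a s) t <= m * / sqrt (1 + C * t)).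
    { apply (sol_le_supersolution mu (rhs_s a s) (fun t => m * / sqrt (1 + C * t))
        (fun t => - m * C / 2 * / sqrt (1 + C * t) ^ 3)
        (fun t => 3 * m * C ^ 2 / 4 * / sqrt (1 + C * t) ^ 5) 0 (/ C));
        auto; try lra.
      - apply mu_pos.
      - intros u hu. destruct (st u ltac:(lra)) as [q0 q1].
        auto_derive; [repeat split; nra|]. field. lra.
      - intros u hu. destruct (st u ltac:(lra)) as [q0 q1].
        auto_derive;
          [repeat split; try nra; apply Rgt_not_eq; apply (pow_lt _ 3 q0)|].
        field. lra.
      - intros u hu. destruct (st u ltac:(lra)) as [q0 q1].
        pose proof adm as [la [ls r]].
        destruct (region_bounds u (a u) (s u) ltac:(lra) (r u ltac:(lra)))
          as [ha [hs [h1 h2]]].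
        destruct (r u ltac:(lra)) as [_ [_ [h3 _]]]. fold C in h3. fold m in h3.
        set (q := sqrt (1 + C * u)) in *.
        set (y := / q).
        assert (y0 : 0 < y) by (apply Rinv_0_lt_compat; lra).
        assert (yq : y * q = 1) by (unfold y; field; lra).
        assert (yy : y ^ 2 * (1 + C * u) = 1).
        { rewrite <- q1. replace (y ^ 2 * (q * q)) with ((y * q) ^ 2) by ring.
          rewrite yq. ring. }
        assert (uC : u * C <= 1) by nra.
        assert (uC0 : 0 <= u * C) by nra.
        assert (y2 : 1 / 2 <= y ^ 2) by nra.
        assert (y1 : y ^ 2 <= 1) by nra.
        assert (E : u * (m * y) ^ 2 = 2 - 2 * y ^ 2).
        { replace (u * (m * y) ^ 2) with (u * (m * m) * y ^ 2) by ring.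
          rewrite mm. nra. }
        apply Rle_trans with
          (shift mu u * (m * y) + src_s lam u (a u) (m * y)).
        + apply rhs_s_le; try assumption; try lra.
          assert (s u = y * (q * s u)) by (rewrite <- Rmult_assoc, yq; ring).
          nra.
        + unfold Rminus. apply Rplus_le_compat_l.
          replace (/ q ^ 5) with (y ^ 5) by (unfold y; field; lra).
          replace (/ q ^ 3) with (y ^ 3) by (unfold y; field; lra).
          replace (- (4 * u * (3 * m * C ^ 2 / 4 * y ^ 5)
             + 10 * (- m * C / 2 * y ^ 3)))
            with (m * y * (C * y ^ 2 * (5 - 3 * (C * u * y ^ 2)))) by field.
          unfold src_s. rewrite E.
          assert (E2 : C * u * y ^ 2 = 1 - y ^ 2) by nra.
          rewrite E2.
          replace (2 * a u * (2 - u * a u) * (m * y)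
             + lam / 2 * (1 - (2 - 2 * y ^ 2)) * (m * y))
            with (m * y * (2 * a u * (2 - u * a u) + lam / 2 * (2 * y ^ 2 - 1)))
            by ring.
          (* Once [m y] is factored out, the left side is at most [4 B + lam / 2 <= C], while on the
             right [y^2 (2 + 3 y^2) >= 1] because [y^2 >= 1 / 2]. *)
          apply Rmult_le_compat_l; [nra|].
          assert (0 <= u * a u) by nra.
          assert (2 * a u * (2 - u * a u) <= 4 * B) by nra.
          assert (lam / 2 * (2 * y ^ 2 - 1) <= lam / 2) by nra.
          assert (C * 1 <= C * (y ^ 2 * (5 - 3 * (1 - y ^ 2))))
            by (apply Rmult_le_compat_l; nra).
          assert (C = 4 * B + lam) by reflexivity.
          nra.
      - assert (S := step_s_singular_bound a s (/ C) adm ltac:(lra)).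
        replace (1 + C * / C) with 2 by (field; lra).
        assert (E : m * / sqrt 2 = sqrt C).
        { unfold m. rewrite sqrt_mult by lra. field.
          apply Rgt_not_eq, sqrt_lt_R0; lra. }
        rewrite E.
        assert (E2 : sqrt C * sqrt (/ C) = 1).
        { rewrite <- sqrt_mult by lra. rewrite Rmult_comm, iC'. apply sqrt_1. }
        assert (0 < sqrt C) by (apply sqrt_lt_R0; lra).
        set (w := sol mu (rhs_s a s) (/ C)) in *.
        replace w with (sqrt C * (sqrt (/ C) * w))
          by (rewrite <- Rmult_assoc, E2; ring).
        nra. }
    destruct (st t ltac:(lra)) as [q0 q1].
    assert (E : sqrt (1 + C * t) * (m * / sqrt (1 + C * t)) = m) by (field; lra).
    nra.
  - assert (S := step_s_singular_bound a s t adm ht).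
    destruct (hX t ht) as [_ [w0 _]].
    set (w := sol mu (rhs_s a s) t) in *.
    destruct (st t ltac:(lra)) as [q0 q1].
    assert (t0 : 0 < sqrt t) by (apply sqrt_lt_R0; lra).
    assert (tt : sqrt t * sqrt t = t) by (apply sqrt_sqrt; lra).
    assert (tw : t * w ^ 2 <= 1).
    { rewrite <- tt at 1. replace (sqrt t * sqrt t * w ^ 2) with ((sqrt t * w) ^ 2)
        by ring.
      rewrite <- (pow1 2). apply pow_incr. split; [nra|easy]. }
    assert (w2 : 0 <= w ^ 2) by apply pow2_ge_0.
    assert (1 < t * C) by nra.
    assert (w ^ 2 <= C) by nra.
    apply Rsqr_incr_0; [|nra|lra]. unfold Rsqr.
    replace (sqrt (1 + C * t) * w * (sqrt (1 + C * t) * w))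
      with (sqrt (1 + C * t) * sqrt (1 + C * t) * w ^ 2) by ring.
    rewrite q1, mm. nra.
Qed.

(** * Monotone iteration and its fixed point *)

Lemma step_admissible a s : admissible a s -> admissible (step_v a s) (step_s a s).
Proof using hc hlam.
  intros adm. destruct (step_lipschitz a s adm) as [l1 l2].
  split; [|split]; auto. intros t ht. unfold step_v, step_s.
  rewrite clip_id by easy.
  destruct (step_sol_bounds a s adm) as [X [_ hX]].
  destruct (hX t ht) as [[p1 _] [p2 _]].
  repeat split; auto.
  - apply step_v_regular_bound; auto.
  - apply step_v_singular_bound; auto.
  - apply step_s_regular_bound; auto.
  - apply step_s_singular_bound; auto.
Qed.

Lemma step_mono a s a' s' : admissible a s -> admissible a' s' ->
  (forall t, 0 <= t <= 1 -> a t <= a' t /\ s t <= s' t) ->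
  forall t, 0 <= t <= 1 ->
    step_v a s t <= step_v a' s' t /\ step_s a s t <= step_s a' s' t.
Proof using hc hlam.
  intros adm adm' le t ht. unfold step_v, step_s. rewrite clip_id by easy.
  destruct (admissible_continuous a s adm) as [cv cs].
  destruct (admissible_continuous a' s' adm') as [cv' cs'].
  assert (K : forall u, 0 <= u <= 1 ->
    rhs_v a s u <= rhs_v a' s' u /\ rhs_s a s u <= rhs_s a' s' u).
  { intros u hu. unfold rhs_v, rhs_s. rewrite clip_id by easy.
    destruct adm as [_ [_ r]]. destruct adm' as [_ [_ r']].
    destruct (region_bounds _ _ _ hu (r u hu)) as [ha [hs [h1 h2]]].
    destruct (region_bounds _ _ _ hu (r' u hu)) as [ha' [hs' [h1' h2']]].
    destruct (shift_ge u ltac:(lra)) as [k1 k2].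
    destruct (le u hu).
    split; [apply src_v_mono|apply src_s_mono]; lra. }
  split; apply sol_le; auto; intros; apply K; auto.
Qed.

(* Tarski: the supremum of all admissible pairs lying below their image is a
   fixed point; it is continuous because admissible pairs are equi-Lipschitz. *)
Lemma fixed_point : exists a s, admissible a s /\
  forall t, 0 <= t <= 1 -> a t = step_v a s t /\ s t = step_s a s t.
Proof using hc hlam.
  set (post := fun a s => admissible a s /\
    forall t, 0 <= t <= 1 -> a t <= step_v a s t /\ s t <= step_s a s t).
  pose proof cap_v_ge as hB. pose proof cap_s_ge as hC.
  assert (L0 : 0 <= lip_const).
  { unfold lip_const, sol_lip, rhs_max. pose proof mu_pos.
    pose proof (exp_pos mu). pose proof (sqrt_pos (2 * C)).
    pose proof (pow2_ge_0 (sqrt (2 * C))). pose proof (pow2_ge_0 B).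
    pose proof (pow2_ge_0 mu).
    repeat first [ apply Rplus_le_le_0_compat | apply Rmult_le_pos ]; lra. }
  assert (zero : post (fun _ => 0) (fun _ => 0)).
  { assert (adm0 : admissible (fun _ => 0) (fun _ => 0)).
    { split; [|split].
      - intros x y. rewrite Rminus_diag, Rabs_R0.
        apply Rmult_le_pos; [easy|apply Rabs_pos].
      - intros x y. rewrite Rminus_diag, Rabs_R0.
        apply Rmult_le_pos; [easy|apply Rabs_pos].
      - intros t ht. unfold region. fold B C.
        pose proof (sqrt_pos (2 * C)). repeat split; lra. }
    split; [easy|]. intros t ht. unfold step_v, step_s. rewrite clip_id by easy.
    destruct (step_sol_bounds _ _ adm0) as [X [_ hX]].
    destruct (hX t ht); lra. }
  assert (bd : forall a s t, post a s ->
    a t <= B + lip_const * Rabs t /\ s t <= sqrt (2 * C) + lip_const * Rabs t).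
  { intros a s t [[la [ls r]] _].
    destruct (region_bounds 0 (a 0) (s 0) ltac:(lra) (r 0 ltac:(lra))) as [ha [hs _]].
    assert (l1 := la t 0). assert (l2 := ls t 0). rewrite Rminus_0_r in l1, l2.
    assert (q1 := Rle_abs (a t - a 0)). assert (q2 := Rle_abs (s t - s 0)). lra. }
  (* The two components are maximised separately, each with its partner quantified away; this is
     legitimate because [region] imposes no joint condition on [a] and [s]. *)
  destruct (lipschitz_sup (fun a => exists s, post a s) lip_const)
    as [V [lV [ubV lubV]]].
  { exists (fun _ => 0), (fun _ => 0). easy. }
  { intros f [s [[l _] _]]. easy. }
  { intros t. eexists. intros f [s h]. apply (bd f s t h). }
  destruct (lipschitz_sup (fun s => exists a, post a s) lip_const)
    as [S [lS [ubS lubS]]].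
  { exists (fun _ => 0), (fun _ => 0). easy. }
  { intros f [s [[_ [l _]] _]]. easy. }
  { intros t. eexists. intros f [s h]. apply (bd s f t h). }
  assert (admVS : admissible V S).
  { split; [|split]; auto. intros t ht.
    assert (V0 : 0 <= V t) by (apply (ubV (fun _ => 0)); eexists; apply zero).
    assert (S0 : 0 <= S t) by (apply (ubS (fun _ => 0)); eexists; apply zero).
    (* Every upper bound in [region] has the form [k x <= m] with [k] depending on [t] only; written
       as [x <= m / k] it passes to the supremum. *)
    assert (sc : forall k m x b, 0 < k -> x <= b / k -> b = m -> k * x <= m).
    { intros k m x b k0 h <-. replace b with (k * (b / k)) by (field; lra). nra. }
    assert (sc' : forall k m x, 0 < k -> k * x <= m -> x <= m / k).
    { intros k m x k0 h. apply Rmult_le_reg_l with k; auto.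
      replace (k * (m / k)) with m by (field; lra). easy. }
    assert (pB : 0 < 1 + B * t / 2) by nra.
    assert (pC : 0 < sqrt (1 + C * t)) by (apply sqrt_lt_R0; nra).
    assert (pt : t = 0 \/ 0 < t) by lra.
    repeat split; auto.
    - rewrite Rmult_comm. eapply sc; [exact pB| |reflexivity].
      apply lubV. intros a [s [[_ [_ r]] _]].
      destruct (r t ht) as [[_ [h _]] _]. apply sc'; auto.
      rewrite Rmult_comm. exact h.
    - destruct pt as [->|pt]; [lra|]. eapply sc; [exact pt| |reflexivity].
      apply lubV. intros a [s [[_ [_ r]] _]].
      destruct (r t ht) as [[_ [_ h]] _]. apply sc'; auto.
    - eapply sc; [exact pC| |reflexivity].
      apply lubS. intros s [a [[_ [_ r]] _]].
      destruct (r t ht) as [_ [_ [h _]]]. apply sc'; auto.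
    - destruct pt as [->|pt]; [rewrite sqrt_0; lra|].
      assert (pq : 0 < sqrt t) by (apply sqrt_lt_R0; lra).
      eapply sc; [exact pq| |reflexivity].
      apply lubS. intros s [a [[_ [_ r]] _]].
      destruct (r t ht) as [_ [_ [_ h]]]. apply sc'; auto. }
  assert (below : forall t, 0 <= t <= 1 -> V t <= step_v V S t /\ S t <= step_s V S t).
  { intros t ht. split.
    - apply lubV. intros a [s p]. pose proof p as [adm le].
      apply Rle_trans with (step_v a s t); [apply le, ht|].
      destruct (step_mono a s V S adm admVS) with (t := t) as [m _]; auto.
      intros u hu. split; [apply (ubV a)|apply (ubS s)]; eexists; apply p.
    - apply lubS. intros s [a p]. pose proof p as [adm le].
      apply Rle_trans with (step_s a s t); [apply le, ht|].
      destruct (step_mono a s V S adm admVS) with (t := t) as [_ m]; auto.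
      intros u hu. split; [apply (ubV a)|apply (ubS s)]; eexists; apply p. }
  (* The image competes in the supremum itself, which yields the reverse inequality. *)
  assert (img : post (step_v V S) (step_s V S)).
  { pose proof (step_admissible V S admVS) as adm'. split; [exact adm'|].
    exact (step_mono V S _ _ admVS adm' below). }
  exists V, S. split; auto. intros t ht. destruct (below t ht) as [b1 b2].
  split; apply Rle_antisym; auto.
  - apply (ubV (step_v V S)). eexists; apply img.
  - apply (ubS (step_s V S)). eexists; apply img.
Qed.

End System.

(** * Regularity at the origin *)

Lemma eq_of_derive (f g df : R -> R) :
  (forall t, 0 < t -> is_derive f t (df t)) ->
  (forall t, 0 < t -> is_derive g t (df t)) ->
  (forall t, continuous f t) -> (forall t, continuous g t) -> f 0 = g 0 ->
  forall t, 0 <= t -> f t = g t.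
Proof.
  intros Df Dg cf cg e0 t ht.
  destruct (MVT_gen (fun t => f t - g t) 0 t (fun _ => 0)) as [x [_ E]].
  - intros u hu. rewrite Rmin_left in hu by lra.
    evar_last; [apply (is_derive_minus f g); [apply Df|apply Dg]; lra|].
    apply (minus_eq_zero (df u)).
  - intros u _. apply (continuity_pt_minus f g);
      apply continuity_pt_filterlim; [apply cf|apply cg].
  - lra.
Qed.

(* Second derivative of [sol mu h] on [t > 0], in a form that stays continuous
   at [t = 0] when [h] has derivative [h0] there. *)
Definition sol'' (mu : R) (h : R -> R) (h0 t : R) : R :=
  mu * sol' mu h t + mu * exp (- mu * t) * avg (weighted mu h) t
  - exp (- mu * t) * avg' (weighted mu h) h0 t.

Lemma continuous_sol'' mu h h0 t :
  (forall x, continuous h x) -> is_derive (weighted mu h) 0 h0 ->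
  continuous (sol'' mu h h0) t.
Proof.
  intros ch d0.
  assert (c1 := continuous_sol' mu h t ch).
  assert (c2 := continuous_avg (weighted mu h) t (continuous_weighted mu h ch)).
  assert (c3 := continuous_avg' (weighted mu h) h0 t
                  (continuous_weighted mu h ch) d0).
  assert (c4 := continuous_exp_lin (- mu) t).
  apply continuity_pt_filterlim in c1.
  apply continuity_pt_filterlim in c2.
  apply continuity_pt_filterlim in c3.
  apply continuity_pt_filterlim in c4.
  apply continuity_pt_filterlim. unfold sol''.
  repeat first [ assumption | apply continuity_pt_const; intros ? ?; reflexivity |
  match goal with
  | |- continuity_pt (fun t => @?f t + @?g t) _ => apply (continuity_pt_plus f g)
  | |- continuity_pt (fun t => @?f t - @?g t) _ => apply (continuity_pt_minus f g)
  | |- continuity_pt (fun t => @?f t * @?g t) _ => apply (continuity_pt_mult f g)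
  end ].
Qed.

Lemma sol''_eq mu h h0 t : 0 < t ->
  sol'' mu h h0 t
  = (shift mu t * sol mu h t - h t - 10 * sol' mu h t) / (4 * t).
Proof.
  intros t0. unfold sol'', avg', sol', shift.
  destruct (Rle_dec t 0); [lra|].
  set (w := avg (weighted mu h) t).
  change (weighted mu h t) with (exp (mu * t) * h t).
  assert (E : exp (mu * t) * exp (- mu * t) = 1).
  { rewrite <- exp_plus, <- exp_0. f_equal. ring. }
  set (p := exp (mu * t)) in *. set (q := exp (- mu * t)) in *.
  set (S := sol mu h t).
  replace (h t) with (p * q * h t) at 2 by (rewrite E; ring).
  field. lra.
Qed.

(** At [0] the one-sided second derivatives of [sol] may differ, since [avg] is constant on the
    negative side. Integrating [sol''] twice from [0] gives a function that is C^2 on the whole line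
    and agrees with [sol] for [t >= 0], so that composing with [|x|^2] needs only the ordinary chain
    rule at the origin. *)
Lemma sol_C2_extension mu h h0 :
  (forall x, continuous h x) -> is_derive (weighted mu h) 0 h0 ->
  exists v v1 v2 : R -> R,
    (forall t, is_derive v t (v1 t)) /\ (forall t, is_derive v1 t (v2 t)) /\
    (forall t, continuous v2 t) /\
    forall t, 0 <= t -> v t = sol mu h t /\
      4 * t * v2 t + 10 * v1 t = shift mu t * v t - h t.
Proof.
  intros ch d0.
  pose proof (fun t => continuous_sol'' mu h h0 t ch d0) as c2.
  set (v2 := sol'' mu h h0) in *.
  set (v1 := fun t => sol' mu h 0 + RInt v2 0 t).
  assert (D1 : forall t, is_derive v1 t (v2 t)).
  { intros t. evar_last.
    - apply (is_derive_plus (fun _ => sol' mu h 0) (fun t => RInt v2 0 t)).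
      + apply is_derive_const.
      + apply is_derive_RInt_cont, c2.
    - apply plus_zero_l. }
  assert (c1 : forall t, continuous v1 t).
  { intros t. apply (ex_derive_continuous v1). eexists; apply D1. }
  set (v := fun t => sol mu h 0 + RInt v1 0 t).
  assert (D : forall t, is_derive v t (v1 t)).
  { intros t. evar_last.
    - apply (is_derive_plus (fun _ => sol mu h 0) (fun t => RInt v1 0 t)).
      + apply is_derive_const.
      + apply is_derive_RInt_cont, c1.
    - apply plus_zero_l. }
  assert (cv : forall t, continuous v t).
  { intros t. apply (ex_derive_continuous v). eexists; apply D. }
  assert (E1 : forall t, 0 <= t -> v1 t = sol' mu h t).
  { apply eq_of_derive with v2; auto.
    - intros t t0. unfold v2. rewrite sol''_eq by easy.
      apply is_derive_sol'; auto.
    - intros; apply continuous_sol', ch.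
    - unfold v1. rewrite RInt_point. apply Rplus_0_r. }
  assert (E : forall t, 0 <= t -> v t = sol mu h t).
  { apply eq_of_derive with v1; auto.
    - intros t t0. rewrite E1 by lra. apply is_derive_sol; auto.
    - intros; apply continuous_sol, ch.
    - unfold v. rewrite RInt_point. apply Rplus_0_r. }
  exists v, v1, v2. split; [exact D|]. split; [exact D1|]. split; [exact c2|].
  intros t ht. split; [auto|].
  rewrite E, E1 by easy.
  destruct (Req_dec t 0) as [->|tn].
  - rewrite sol'_0. ring.
  - unfold v2. rewrite sol''_eq by lra. field. lra.
Qed.

Lemma sol_ext mu h1 h2 t :
  (forall x, continuous h1 x) -> (forall x, continuous h2 x) ->
  (forall u, 0 <= u <= 1 -> h1 u = h2 u) -> 0 <= t <= 1 ->
  sol mu h1 t = sol mu h2 t.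
Proof.
  intros c1 c2 e ht.
  apply Rle_antisym; apply sol_le; auto; intros; rewrite e; auto; lra.
Qed.

(** A bootstrap: the fixed point is only known to be Lipschitz, but on [[0, 1]] it equals [sol] of
    its own source and so is C^1; the unclipped source is then differentiable at [0], as
    [sol_C2_extension] requires. *)
Theorem radial_system (c lam : R) : 0 < c -> 0 <= lam ->
  exists v v1 v2 s s1 s2 : R -> R,
    ((forall t, derivable_pt_lim v t (v1 t)) /\
     (forall t, derivable_pt_lim v1 t (v2 t)) /\ continuity v2 /\ v 1 = 1) /\
    ((forall t, derivable_pt_lim s t (s1 t)) /\
     (forall t, derivable_pt_lim s1 t (s2 t)) /\ continuity s2 /\ s 1 = 1) /\
    forall t, 0 <= t <= 1 ->
      4 * t * v2 t + 10 * v1 t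
        = - v t ^ 2 * (3 - t * v t) - c * s t ^ 2 * (1 - t * v t) /\
      4 * t * s2 t + 10 * s1 t
        = - 2 * v t * (2 - t * v t) * s t + lam / 2 * (t * s t ^ 2 - 1) * s t.
Proof.
  intros hc hlam.
  destruct (fixed_point c lam hc hlam) as [a [b [adm fix_ab]]].
  set (mu := c + lam) in *.
  destruct (admissible_continuous c lam a b adm) as [ca cb].
  set (ha := rhs_v c lam a b) in *. set (hb := rhs_s c lam a b) in *.
  set (A := sol mu ha). set (Bs := sol mu hb).
  assert (EA : forall t, 0 <= t <= 1 -> a t = A t /\ b t = Bs t).
  { intros t ht. destruct (fix_ab t ht) as [e1 e2].
    unfold step_v, step_s in e1, e2. rewrite clip_id in e1, e2 by easy.
    split; [exact e1|exact e2]. }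
  (* The right-hand sides are recomputed from the C^1 functions [A] and [Bs]. *)
  set (ga := fun t => src_v c t (A t) (Bs t) + shift mu t * A t).
  set (gb := fun t => src_s lam t (A t) (Bs t) + shift mu t * Bs t).
  assert (DA : forall t, ex_derive A t)
    by (intros t; eexists; apply is_derive_sol, ca).
  assert (DB : forall t, ex_derive Bs t)
    by (intros t; eexists; apply is_derive_sol, cb).
  assert (Dga : forall t, ex_derive ga t).
  { intros t. unfold ga, src_v, shift. auto_derive. repeat split; auto. }
  assert (Dgb : forall t, ex_derive gb t).
  { intros t. unfold gb, src_s, shift. auto_derive. repeat split; auto. }
  assert (cga : forall t, continuous ga t)
    by (intros t; apply (ex_derive_continuous ga), Dga).
  assert (cgb : forall t, continuous gb t)
    by (intros t; apply (ex_derive_continuous gb), Dgb).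
  assert (W : forall g, (forall t, ex_derive g t) -> ex_derive (weighted mu g) 0).
  { intros g Dg. unfold weighted. auto_derive. repeat split; auto. }
  destruct (W ga Dga) as [wa Wa]. destruct (W gb Dgb) as [wb Wb].
  destruct (sol_C2_extension mu ga wa cga Wa) as [v [v1 [v2 [V1 [V2 [cV V]]]]]].
  destruct (sol_C2_extension mu gb wb cgb Wb) as [s [s1 [s2 [S1 [S2 [cS S]]]]]].
  assert (Ev : forall t, 0 <= t <= 1 -> v t = A t).
  { intros t ht. destruct (V t ltac:(lra)) as [-> _].
    apply sol_ext; auto. intros u hu. destruct (EA u hu) as [e1 e2].
    unfold ga, ha, rhs_v. rewrite clip_id by easy. rewrite e1, e2. reflexivity. }
  assert (Es : forall t, 0 <= t <= 1 -> s t = Bs t).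
  { intros t ht. destruct (S t ltac:(lra)) as [-> _].
    apply sol_ext; auto. intros u hu. destruct (EA u hu) as [e1 e2].
    unfold gb, hb, rhs_s. rewrite clip_id by easy. rewrite e1, e2. reflexivity. }
  exists v, v1, v2, s, s1, s2. split; [|split].
  - repeat split.
    + intros t. apply is_derive_Reals, V1.
    + intros t. apply is_derive_Reals, V2.
    + intros t. apply continuity_pt_filterlim, cV.
    + rewrite Ev by lra. apply sol_1.
  - repeat split.
    + intros t. apply is_derive_Reals, S1.
    + intros t. apply is_derive_Reals, S2.
    + intros t. apply continuity_pt_filterlim, cS.
    + rewrite Es by lra. apply sol_1.
  - intros t ht. destruct (V t ltac:(lra)) as [_ ->].
    destruct (S t ltac:(lra)) as [_ ->].
    unfold ga, gb. rewrite <- Ev, <- Es by easy. unfold src_v, src_s. split; field.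
Qed.

Theorem radial_profile (lam eps : R) : 0 <= lam -> 0 < eps ->
  exists k k' k'' s s' s'' : R -> R,
    ((forall t, derivable_pt_lim k t (k' t)) /\
     (forall t, derivable_pt_lim k' t (k'' t)) /\ continuity k'' /\
     1 + 2 * k 1 = 0) /\
    ((forall t, derivable_pt_lim s t (s' t)) /\
     (forall t, derivable_pt_lim s' t (s'' t)) /\ continuity s'' /\ s 1 = 1) /\
    forall t, 0 <= t <= 1 ->
      eps * (4 * t * k'' t + 10 * k' t - 6 * k t ^ 2 - 4 * t * k t ^ 3)
        = 2 * s t ^ 2 * (1 + 2 * t * k t) /\
      4 * t * s'' t + 10 * s' t - 8 * k t * s t - 8 * t * k t ^ 2 * s t
        = lam / 2 * (t * s t ^ 2 - 1) * s t.
Proof.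
  intros hlam heps.
  destruct (radial_system (4 / eps) lam) as
    [v [v1 [v2 [s [s1 [s2 [[V1 [V2 [cV v1v]]] [[S1 [S2 [cS s1v]]] ode]]]]]]]].
  { apply Rdiv_lt_0_compat; lra. }
  { easy. }
  assert (half : forall f f1 : R -> R, (forall t, derivable_pt_lim f t (f1 t)) ->
    forall t, derivable_pt_lim (fun u => - / 2 * f u) t (- / 2 * f1 t)).
  { intros f f1 h t. apply (derivable_pt_lim_scal f), h. }
  exists (fun t => - / 2 * v t), (fun t => - / 2 * v1 t), (fun t => - / 2 * v2 t),
    s, s1, s2.
  split; [|split; [easy|]].
  - repeat split; auto.
    + intros t. apply (continuity_pt_scal v2), cV.
    + rewrite v1v. field.
  - intros t ht. destruct (ode t ht) as [e1 e2]. split.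
    + replace (4 * t * (- / 2 * v2 t) + 10 * (- / 2 * v1 t))
        with (- / 2 * (4 * t * v2 t + 10 * v1 t)) by ring.
      rewrite e1. field. lra.
    + rewrite e2. field.
Qed.

End Radial.

From mathcomp Require Import all_boot all_order all_algebra.
From mathcomp Require Import all_classical all_reals all_analysis.
From mathcomp Require Import Rstruct Rstruct_topology.
From mathcomp Require Import ring.
Import Order.TTheory GRing.Theory Num.Theory.
Import numFieldNormedType.Exports.
Local Open Scope classical_set_scope.
Local Open Scope ring_scope.

(** * Vector algebra in dimension 3 *)

Definition o0 : 'I_3 := @Ordinal 3 0 isT.
Definition o1 : 'I_3 := @Ordinal 3 1 isT.
Definition o2 : 'I_3 := @Ordinal 3 2 isT.

Lemma I3_ind (P : 'I_3 -> Prop) : P o0 -> P o1 -> P o2 -> forall i, P i.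
Proof.
move=> P0 P1 P2 [[|[|[|//]]] hi].
- by have -> : Ordinal hi = o0 by exact: val_inj.
- by have -> : Ordinal hi = o1 by exact: val_inj.
- by have -> : Ordinal hi = o2 by exact: val_inj.
Qed.

Lemma sum3 (V : nmodType) (F : 'I_3 -> V) :
  \sum_i F i = F o0 + F o1 + F o2.
Proof.
rewrite !big_ord_recl big_ord0 addr0 addrA.
by congr (F _ + F _ + F _); apply: val_inj.
Qed.

Section Algebra3.
Set Implicit Arguments.
Unset Strict Implicit.
Unset Printing Implicit Defensive.
Context {R : realType}.
Implicit Types (u v x : 'cV[R]_3) (a b c : 'I_3).

Lemma eq_vec3 u v :
  u o0 0 = v o0 0 -> u o1 0 = v o1 0 -> u o2 0 = v o2 0 -> u = v.
Proof.
move=> h0 h1 h2; apply/matrixP => i j; rewrite (ord1 j).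
by move: i; apply: I3_ind.
Qed.

Lemma evecE : ((evec o0 o0 0 = 1 :> R) * (evec o0 o1 0 = 0 :> R) *
  (evec o0 o2 0 = 0 :> R) * (evec o1 o0 0 = 0 :> R) * (evec o1 o1 0 = 1 :> R) *
  (evec o1 o2 0 = 0 :> R) * (evec o2 o0 0 = 0 :> R) * (evec o2 o1 0 = 0 :> R) *
  (evec o2 o2 0 = 1 :> R))%type.
Proof. by rewrite /evec !mxE. Qed.

Lemma levi_swap a b c : levi a b c = - levi a c b :> R.
Proof. rewrite /levi; ring. Qed.

Lemma levi_swap' a b c : levi a b c = - levi b a c :> R.
Proof. rewrite /levi; ring. Qed.

Lemma levi_rep a b : ((levi a a b = 0 :> R) * (levi a b a = 0 :> R) *
  (levi b a a = 0 :> R))%type.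
Proof. by rewrite /levi !subrr !mulr0 !mul0r. Qed.

Lemma levi012 : levi o0 o1 o2 = 1 :> R.
Proof.
by rewrite /levi /= !subr0 mul1r -(natrB R (isT : (1 <= 2)%N)) mulr1 divff.
Qed.

Lemma leviE : ((levi o0 o1 o2 = 1 :> R) * (levi o0 o2 o1 = -1 :> R) *
  (levi o1 o2 o0 = 1 :> R) * (levi o1 o0 o2 = -1 :> R) *
  (levi o2 o0 o1 = 1 :> R) * (levi o2 o1 o0 = -1 :> R))%type.
Proof.
have h1 : levi o0 o2 o1 = -1 :> R by rewrite levi_swap levi012.
have h2 : levi o2 o0 o1 = 1 :> R by rewrite levi_swap' h1 opprK.
have h3 : levi o1 o0 o2 = -1 :> R by rewrite levi_swap' levi012.
have h4 : levi o1 o2 o0 = 1 :> R by rewrite levi_swap h3 opprK.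
by rewrite levi012 h1 h2 h3 h4 (levi_swap o2 o1) h2.
Qed.

Lemma crossE u v : ((cross u v o0 0 = u o1 0 * v o2 0 - u o2 0 * v o1 0) *
  (cross u v o1 0 = u o2 0 * v o0 0 - u o0 0 * v o2 0) *
  (cross u v o2 0 = u o0 0 * v o1 0 - u o1 0 * v o0 0))%type.
Proof.
by rewrite /cross !mxE !sum3 !levi_rep !leviE; split; [split|]; ring.
Qed.

Lemma lieE u v : lie u v = 2 *: cross u v.
Proof.
rewrite /lie /qmul /= !scale0r !add0r; apply/eq_vec3;
  by rewrite [RHS]mxE [LHS]mxE [X in _ + X]mxE !crossE; ring.
Qed.

Lemma star2E (G : form2 R) x :
  ((star2 G o0 x = 2^-1 *: (G o1 o2 x - G o2 o1 x)) *
   (star2 G o1 x = 2^-1 *: (G o2 o0 x - G o0 o2 x)) *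
   (star2 G o2 x = 2^-1 *: (G o0 o1 x - G o1 o0 x)))%type.
Proof.
rewrite /star2 !sum3 !levi_rep !leviE !scale0r !scale1r !scaleN1r.
rewrite !addr0 !add0r; split; [split|] => //.
by congr (_ *: _); rewrite addrC.
Qed.

Lemma star3E (H : form3 R) x :
  star3 H x = 6^-1 *: (H o0 o1 o2 x - H o0 o2 o1 x - H o1 o0 o2 x + H o1 o2 o0 x
    + H o2 o0 o1 x - H o2 o1 o0 x).
Proof.
rewrite /star3 !sum3 !levi_rep !leviE !scale0r !scale1r !scaleN1r.
by rewrite !addr0 !add0r !addrA.
Qed.

End Algebra3.

(** * Differentiation of radial expressions *)

Section Calculus3.
Set Implicit Arguments.
Unset Strict Implicit.
Unset Printing Implicit Defensive.
Context {R : realType}.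
Local Notation V := 'cV[R]_3.
Implicit Types (x v : V) (F G : V -> R) (a i : 'I_3).

Lemma is_derive_coord x v i :
  is_derive x v (fun y : V => y i 0) (v i 0).
Proof.
suff h : (fun h : R => h^-1 *: (((fun y : V => y i 0) \o shift x) (h *: v)
    - x i 0)) @ 0^' --> v i 0.
  by apply: DeriveDef; [apply/cvg_ex; exists (v i 0)|exact/cvg_lim].
apply: cvg_near_cst; near=> h => /=.
have h0 : h != 0 by near: h; exact: nbhs_dnbhs_neq.
by rewrite !mxE addrK /GRing.scale /= mulrA mulVf ?mul1r.
Unshelve. all: by end_near. Qed.

(** A directional derivative is an ordinary derivative along the line [h *: v + x], so the
    one-variable chain rule suffices and [F] need not be differentiable in the full sense. *)
Lemma is_derive_comp_line (g : R -> R) F x v (dg dF : R) :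
  is_derive (F x) 1 g dg -> is_derive x v F dF ->
  is_derive x v (g \o F) (dg * dF).
Proof.
move=> hg hF.
have line (f : V -> R) df : is_derive x v f df <->
    is_derive (0 : R) (1 : R) (fun h : R => f (h *: v + x)) df.
  have E : 'D_v f x = 'D_1 (fun h : R => f (h *: v + x)) 0.
    rewrite /derive; set g1 := fun h => h^-1 *: _; set g2 := fun h => h^-1 *: _.
    suff -> : g1 = g2 by [].
    by apply/funext => h; rewrite /g1 /g2 /= addr0 scale0r add0r [_%:A]mulr1.
  split=> -[h1 h2].
  - by split; [exact: ((derivable1P f x v).1 h1)|rewrite -E].
  - by split; [exact: ((derivable1P f x v).2 h1)|rewrite E].
apply/line; apply: is_derive1_comp; last exact/line.
by rewrite scale0r add0r.
Qed.

Definition sq x : R := dotv x x.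

Lemma sqE x : sq x = x o0 0 ^+ 2 + x o1 0 ^+ 2 + x o2 0 ^+ 2.
Proof. by rewrite /sq /dotv sum3 !expr2. Qed.

Lemma is_derive_sq x v : is_derive x v sq (2 * dotv x v).
Proof.
pose f i : V -> R := fun y => y i 0.
have D i : is_derive x v (f i) (v i 0) := is_derive_coord x v i.
have D2 i : is_derive x v (f i * f i) (2 * (x i 0 * v i 0)).
  by apply: is_derive_eq; rewrite /f /GRing.scale /=; ring.
have -> : sq = f o0 * f o0 + f o1 * f o1 + f o2 * f o2.
  by apply/funext => y; rewrite sqE !expr2.
by apply: (is_derive_eq (is_deriveD (is_deriveD (D2 o0) (D2 o1)) (D2 o2)));
  rewrite /dotv sum3; ring.
Qed.

Lemma dotv_evec x a : dotv x (evec a) = x a 0.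
Proof.
by rewrite /dotv sum3; move: a; apply: I3_ind; rewrite !evecE;
  rewrite !mulr0 !mulr1 ?add0r ?addr0.
Qed.

Lemma continuous_sq : continuous sq.
Proof.
pose f i : V -> R := fun y => y i 0.
have -> : sq = f o0 * f o0 + f o1 * f o1 + f o2 * f o2.
  by apply/funext => y; rewrite sqE !expr2.
have cf i : continuous (f i) by exact: coord_continuous.
by move=> x; apply: continuousD; [apply: continuousD|]; apply: continuousM; exact: cf.
Qed.

Lemma continuous_col (F : 'I_3 -> V -> R) x :
  (forall i, {for x, continuous (F i)}) ->
  {for x, continuous (fun y => (\col_i F i y : V))}.
Proof.
move=> cF; rewrite /prop_for /continuous_at.
apply/(@cvgrPdist_le _ _ _ (nbhs x) (nbhs_filter x)) => /= e e0.
near=> y.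
rewrite /Num.Def.normr/= mx_normrE (bigmax_le _ (ltW e0))//= => i _.
rewrite !mxE/=.
move: i; near: y; apply: filter_forall => /= i.
exact: ((cvgrPdist_le _ _).1 (cF i.1)).
Unshelve. all: by end_near. Qed.

(** Global on the whole space: the profiles live on the whole line, so the partial derivatives
    themselves are the continuous extensions to the closed ball that [C1_closed] asks for. *)
Definition C1fun F := continuous F /\
  forall a, (forall x, derivable F x (evec a)) /\ continuous ('D_(evec a) F).
Definition C2fun F := C1fun F /\ forall a, C1fun ('D_(evec a) F).

Lemma C1fun_cst (k : R) : C1fun (cst k).
Proof.
split; first exact: cst_continuous.
move=> a; split; first by move=> x; exact: derivable_cst.
have -> : 'D_(evec a) (cst k : V -> R) = cst 0.
  by apply/funext => x; rewrite derive_cst.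
exact: cst_continuous.
Qed.

Lemma C1funM F G : C1fun F -> C1fun G -> C1fun (F * G).
Proof.
move=> [cF dF] [cG dG]; split; first by move=> x; exact: (continuousM (cF x) (cG x)).
move=> a; case: (dF a) (dG a) => DF cDF [DG cDG]; split.
  by move=> x; apply: derivableM.
have -> : 'D_(evec a) (F * G) = F * 'D_(evec a) G + G * 'D_(evec a) F.
  by apply/funext => x; rewrite deriveM.
by move=> x; apply: continuousD; apply: continuousM;
  [exact: cF|exact: cDG|exact: cG|exact: cDF].
Qed.

Lemma C1funD F G : C1fun F -> C1fun G -> C1fun (F + G).
Proof.
move=> [cF dF] [cG dG]; split; first by move=> x; exact: (continuousD (cF x) (cG x)).
move=> a; case: (dF a) (dG a) => DF cDF [DG cDG]; split.
  by move=> x; apply: derivableD.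
have -> : 'D_(evec a) (F + G) = 'D_(evec a) F + 'D_(evec a) G.
  by apply/funext => x; rewrite deriveD.
by move=> x; apply: continuousD; [exact: cDF|exact: cDG].
Qed.

Lemma C2funM F G : C2fun F -> C2fun G -> C2fun (F * G).
Proof.
move=> [F1 F2] [G1 G2]; split; first exact: C1funM.
move=> a.
have -> : 'D_(evec a) (F * G) = F * 'D_(evec a) G + G * 'D_(evec a) F.
  by apply/funext => x; rewrite deriveM//; [exact: (F1.2 a).1|exact: (G1.2 a).1].
by apply: C1funD; apply: C1funM.
Qed.

Lemma C2funD F G : C2fun F -> C2fun G -> C2fun (F + G).
Proof.
move=> [F1 F2] [G1 G2]; split; first exact: C1funD.
move=> a.
have -> : 'D_(evec a) (F + G) = 'D_(evec a) F + 'D_(evec a) G.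
  by apply/funext => x; rewrite deriveD//; [exact: (F1.2 a).1|exact: (G1.2 a).1].
exact: C1funD.
Qed.

Lemma C2fun_cst (k : R) : C2fun (cst k).
Proof.
split; first exact: C1fun_cst.
move=> a; have -> : 'D_(evec a) (cst k : V -> R) = cst 0.
  by apply/funext => x; rewrite derive_cst.
exact: C1fun_cst.
Qed.

Lemma C1_coord i : C1fun (fun y : V => y i 0).
Proof.
split; first exact: coord_continuous.
move=> a; split; first by move=> x; exact: (@ex_derive _ _ _ _ _ _ _ (is_derive_coord x _ i)).
have -> : 'D_(evec a) (fun y : V => y i 0) = cst (evec a i 0).
  by apply/funext => x; exact: (@derive_val _ _ _ _ _ _ _ (is_derive_coord x _ i)).
exact: cst_continuous.
Qed.

Lemma C2_coord i : C2fun (fun y : V => y i 0).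
Proof.
split; first exact: C1_coord.
move=> a; have -> : 'D_(evec a) (fun y : V => y i 0) = cst (evec a i 0).
  by apply/funext => x; exact: (@derive_val _ _ _ _ _ _ _ (is_derive_coord x _ i)).
exact: C1fun_cst.
Qed.

Lemma is_derive_radial (g : R -> R) (dg : R) x a :
  is_derive (sq x) 1 g dg -> is_derive x (evec a) (g \o sq) (2 * x a 0 * dg).
Proof.
move=> hg; apply: is_derive_eq.
  exact: (is_derive_comp_line hg (is_derive_sq x _)).
by rewrite dotv_evec mulrC.
Qed.

Lemma C1_radial (g g' : R -> R) :
  (forall t : R, is_derive t (1 : R) g (g' t)) -> continuous g' -> C1fun (g \o sq).
Proof.
move=> Dg cg'.
have cg : continuous g.
  by move=> t; apply/differentiable_continuous/derivable1_diffP; have [] := Dg t.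
have comp (h : R -> R) : continuous h -> continuous (h \o sq).
  by move=> ch x; apply: continuous_comp; [exact: continuous_sq|exact: ch].
split; first exact: comp.
move=> a; have D x := is_derive_radial a (Dg (sq x)).
split; first by move=> x; have [] := D x.
have -> : 'D_(evec a) (g \o sq) = cst 2 * (fun y : V => y a 0) * (g' \o sq).
  by apply/funext => x; have [_ ->] := D x.
move=> x; apply: continuousM; last exact: comp.
by apply: continuousM; [exact: cst_continuous|exact: coord_continuous].
Qed.

(** A partial derivative of [g \o sq] is [2 x_a] times [g' \o sq], again a coordinate times a radial
    function; the origin is not exceptional. *)
Lemma C2_radial (g g' g'' : R -> R) :
  (forall t : R, is_derive t (1 : R) g (g' t)) -> (forall t : R, is_derive t (1 : R) g' (g'' t)) ->
  continuous g'' -> C2fun (g \o sq).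
Proof.
move=> Dg Dg' cg''.
have cg' : continuous g'.
  by move=> t; apply/differentiable_continuous/derivable1_diffP; have [] := Dg' t.
split; first exact: (C1_radial Dg).
move=> a.
have -> : 'D_(evec a) (g \o sq) = cst 2 * (fun y : V => y a 0) * (g' \o sq).
  by apply/funext => x; have [_ ->] := is_derive_radial a (Dg (sq x)).
apply: C1funM; last exact: (C1_radial Dg').
by apply: C1funM; [exact: C1fun_cst|exact: C1_coord].
Qed.

Lemma derivable_col (F : 'I_3 -> V -> R) x v :
  (forall i, derivable (F i) x v) -> derivable (fun y => (\col_i F i y : V)) x v.
Proof.
move=> dF; apply/derivable_mxP => i j.
have -> : (fun y => (\col_i F i y : V) i j) = F i by apply/funext => y; rewrite mxE.
exact: dF.
Qed.

Lemma derive_col (F : 'I_3 -> V -> R) x v :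
  (forall i, derivable (F i) x v) ->
  'D_v (fun y => (\col_i F i y : V)) x = \col_i 'D_v (F i) x.
Proof.
move=> dF; rewrite derive_mx; last exact: derivable_col.
apply/matrixP => i j; rewrite !mxE; congr ('D_v _ x).
by apply/funext => y; rewrite mxE.
Qed.

Lemma C1_on_col (U : set V) (F : 'I_3 -> V -> R) :
  (forall i, C1fun (F i)) -> C1_on U (fun y => \col_i F i y).
Proof.
move=> hF a; have dF x i : derivable (F i) x (evec a) by apply: ((hF i).2 a).1.
split=> x _; first by apply: derivable_col => i; exact: dF.
have -> : pd a (fun y => \col_i F i y) = fun x => \col_i 'D_(evec a) (F i) x.
  by apply/funext => y; rewrite /pd derive_col// => i; exact: dF.
by apply: continuous_col => i; exact: ((hF i).2 a).2.
Qed.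

Lemma classical_reg_col (F : 'I_3 -> V -> R) :
  (forall i, C2fun (F i)) -> classical_reg (fun y => \col_i F i y).
Proof.
move=> hF; have h1 i : C1fun (F i) := (hF i).1.
have E a : pd a (fun y => \col_i F i y) = fun x => \col_i 'D_(evec a) (F i) x.
  by apply/funext => y; rewrite /pd derive_col// => i; exact: ((h1 i).2 a).1.
split; first split.
- exact: C1_on_col.
- by move=> a; rewrite E; apply: C1_on_col => i; exact: (hF i).2.
split.
- by apply: continuous_subspaceT => x; apply: continuous_col => i; exact: (h1 i).1.
- exact: C1_on_col.
- move=> a; exists (pd a (fun y => \col_i F i y)); split=> //.
  rewrite E; apply: continuous_subspaceT => x.
  by apply: continuous_col => i; exact: ((h1 i).2 a).2.
Qed.

End Calculus3.

(** * The hedgehog ansatz *)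

Section Hedgehog.
Set Implicit Arguments.
Unset Strict Implicit.
Unset Printing Implicit Defensive.
Context {R : realType}.
Local Notation V := 'cV[R]_3.
Implicit Types (x u v : V) (F G : V -> R) (a b c i : 'I_3) (k s P Q : R -> R).

Lemma entryD u v i : (u + v) i 0 = u i 0 + v i 0. Proof. by rewrite mxE. Qed.
Lemma entryN u i : (- u) i 0 = - u i 0. Proof. by rewrite mxE. Qed.
Lemma entryZ (r : R) u i : (r *: u) i 0 = r * u i 0. Proof. by rewrite mxE. Qed.
Definition entryE := (entryD, entryN, entryZ).

Lemma is_derive_col (F : 'I_3 -> V -> R) x v (dF : V) :
  (forall i, is_derive x v (F i) (dF i 0)) ->
  is_derive x v (fun y => (\col_i F i y : V)) dF.
Proof.
move=> D; have h i : derivable (F i) x v by have [] := D i.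
split; first exact: derivable_col.
rewrite derive_col//; apply/matrixP => i j; rewrite (ord1 j) mxE.
by have [_ ->] := D i.
Qed.

Lemma is_derive_smul F (w : V -> V) x v (dF : R) (dw : V) :
  is_derive x v F dF -> (forall i, is_derive x v (fun y => w y i 0) (dw i 0)) ->
  is_derive x v (fun y => F y *: w y) (dF *: w x + F x *: dw).
Proof.
move=> DF Dw.
have -> : (fun y => F y *: w y) = fun y => (\col_i (F * (fun z => w z i 0)) y : V).
  by apply/funext => y; apply/matrixP => i j; rewrite (ord1 j) !mxE.
apply: is_derive_col => i; apply: is_derive_eq; rewrite !entryE /GRing.scale /=.
ring.
Qed.

Lemma is_derive_cross x v u i :
  is_derive x v (fun y => cross y u i 0) (cross v u i 0).
Proof.
have D j : is_derive x v (fun y : V => y j 0) (v j 0) := is_derive_coord x v j.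
have gen j l : is_derive x v (fun y : V => y j 0 * u l 0 - y l 0 * u j 0)
    (v j 0 * u l 0 - v l 0 * u j 0).
  have -> : (fun y : V => y j 0 * u l 0 - y l 0 * u j 0) =
     (fun y : V => y j 0) * cst (u l 0) - (fun y : V => y l 0) * cst (u j 0) by [].
  by apply: is_derive_eq; rewrite /cst /GRing.scale /=; ring.
move: i; apply: I3_ind.
- rewrite crossE; have -> : (fun y => cross y u o0 0) = 
    (fun y => y o1 0 * u o2 0 - y o2 0 * u o1 0); last exact: gen.
  by apply/funext => y; rewrite crossE.
- rewrite crossE; have -> : (fun y => cross y u o1 0) = 
    (fun y => y o2 0 * u o0 0 - y o0 0 * u o2 0); last exact: gen.
  by apply/funext => y; rewrite crossE.
- rewrite crossE; have -> : (fun y => cross y u o2 0) = 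
    (fun y => y o0 0 * u o1 0 - y o1 0 * u o0 0); last exact: gen.
  by apply/funext => y; rewrite crossE.
Qed.

Definition hedge_conn k : form1 R := fun a x => k (sq x) *: cross x (evec a).
Definition hedge_higgs s : form0 R := fun x => s (sq x) *: x.
(** The common shape of [star2 (curv A)] and [covd0 A phi] for hedgehog data; one pair of formulas
    for its covariant derivatives therefore serves both field equations. *)
Definition hedge_form P Q : form1 R :=
  fun c x => P (sq x) *: evec c + (Q (sq x) * x c 0) *: x.

Lemma pd_conn k (dk : R) a b x : is_derive (sq x) (1 : R) k dk ->
  pd a (hedge_conn k b) x
  = (2 * x a 0 * dk) *: cross x (evec b) + k (sq x) *: cross (evec a) (evec b).
Proof.
move=> Dk; have D := is_derive_radial a Dk.
by have [] := @is_derive_smul _ (fun y => cross y (evec b)) x (evec a) _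
  (cross (evec a) (evec b)) D (is_derive_cross x (evec a) (evec b)).
Qed.

Lemma pd_higgs s (ds : R) a x : is_derive (sq x) (1 : R) s ds ->
  pd a (hedge_higgs s) x = (2 * x a 0 * ds) *: x + s (sq x) *: evec a.
Proof.
move=> Ds; have D := is_derive_radial a Ds.
by have [] := @is_derive_smul _ id x (evec a) _ (evec a) D
  (is_derive_coord x (evec a)).
Qed.

Lemma is_derive_form P Q (dP dQ : R) a b x :
  is_derive (sq x) (1 : R) P dP -> is_derive (sq x) (1 : R) Q dQ ->
  is_derive x (evec a) (hedge_form P Q b)
  ((2 * x a 0 * dP) *: evec b
    + ((2 * x a 0 * dQ * x b 0 + Q (sq x) * evec a b 0) *: x
       + (Q (sq x) * x b 0) *: evec a)).
Proof.
move=> DP DQ; have D1 := is_derive_radial a DP.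
have D2 := is_derive_radial a DQ.
have Dc := is_derive_coord x (evec a) b.
have D3 : is_derive x (evec a) ((Q \o sq) * (fun y : V => y b 0))
    (2 * x a 0 * dQ * x b 0 + Q (sq x) * evec a b 0).
  by apply: is_derive_eq; rewrite /GRing.scale /=; ring.
have D4 := @is_derive_smul _ id x (evec a) _ (evec a) D3
  (is_derive_coord x (evec a)).
have D0 i : is_derive x (evec a) (fun _ => evec b i 0) ((0 : V) i 0).
  by rewrite [(0 : V) i 0]mxE; exact: is_derive_cst.
have D5 := @is_derive_smul _ (fun _ => evec b) x (evec a) _ 0 D1 D0.
have [h E] := is_deriveD D5 D4; split; first exact: h.
by etransitivity; [exact: E|rewrite scaler0 addr0].
Qed.

Lemma pd_form P Q (dP dQ : R) a b x :
  is_derive (sq x) (1 : R) P dP -> is_derive (sq x) (1 : R) Q dQ ->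
  pd a (hedge_form P Q b) x
  = (2 * x a 0 * dP) *: evec b
    + ((2 * x a 0 * dQ * x b 0 + Q (sq x) * evec a b 0) *: x
       + (Q (sq x) * x b 0) *: evec a).
Proof. by move=> DP DQ; have [] := is_derive_form a b DP DQ. Qed.

Lemma pd_formN P Q (dP dQ : R) a b x :
  is_derive (sq x) (1 : R) P dP -> is_derive (sq x) (1 : R) Q dQ ->
  pd a (fun y => - hedge_form P Q b y) x = - pd a (hedge_form P Q b) x.
Proof.
by move=> DP DQ; have [h _] := is_derive_form a b DP DQ; rewrite /pd -deriveN.
Qed.

Lemma star2_curv_conn k k' c x : (forall t : R, is_derive t (1 : R) k (k' t)) ->
  star2 (curv (hedge_conn k)) c x
  = hedge_form (fun t => 2 * (t * k' t + k t)) (fun t => 2 * (k t ^+ 2 - k' t)) c x.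
Proof.
move=> Dk; rewrite /hedge_form.
have E a b : curv (hedge_conn k) a b x = 
  (2 * x a 0 * k' (sq x)) *: cross x (evec b) + k (sq x) *: cross (evec a) (evec b)
  - ((2 * x b 0 * k' (sq x)) *: cross x (evec a)
     + k (sq x) *: cross (evec b) (evec a))
  + 2 *: cross (k (sq x) *: cross x (evec a)) (k (sq x) *: cross x (evec b)).
  by rewrite /curv !(pd_conn _ _ (Dk _)) lieE.
(* The profile values are generalised before [sq] is expanded, which leaves polynomial identities in
   the coordinates. *)
move: c; apply: I3_ind; rewrite star2E !E;
  apply: eq_vec3; do ![rewrite !(entryE, crossE, evecE)];
  move: (k (sq x)) (k' (sq x)) => y y'; rewrite sqE;
  move: (x o0 0) (x o1 0) (x o2 0) => x0 x1 x2; by field.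
Qed.

Lemma covd0_hedge k s s' c x : (forall t : R, is_derive t (1 : R) s (s' t)) ->
  covd0 (hedge_conn k) (hedge_higgs s) c x
  = hedge_form (fun t => s t * (1 + 2 * t * k t))
      (fun t => 2 * (s' t - k t * s t)) c x.
Proof.
move=> Ds; rewrite /covd0 (pd_higgs _ (Ds _)) lieE /hedge_form /hedge_conn
  /hedge_higgs.
move: c; apply: I3_ind;
  apply: eq_vec3; do ![rewrite !(entryE, crossE, evecE)];
  move: (k (sq x)) (s (sq x)) (s' (sq x)) => y z z'; rewrite sqE;
  move: (x o0 0) (x o1 0) (x o2 0) => x0 x1 x2; ring.
Qed.

Lemma star2_covd1_hedge k P Q (dP dQ : R) c x :
  is_derive (sq x) (1 : R) P dP -> is_derive (sq x) (1 : R) Q dQ ->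
  star2 (covd1 (hedge_conn k) (hedge_form P Q)) c x
  = (- 2 * dP + Q (sq x) + 2 * k (sq x) * (P (sq x) + sq x * Q (sq x)))
    *: cross x (evec c).
Proof.
move=> DP DQ.
move: c; apply: I3_ind; rewrite star2E /covd1 !(pd_form _ _ DP DQ) !lieE
  /hedge_form /hedge_conn;
  apply: eq_vec3; do ![rewrite !(entryE, crossE, evecE)];
  move: (k (sq x)) (P (sq x)) (Q (sq x)) => y z w; rewrite sqE;
  move: (x o0 0) (x o1 0) (x o2 0) => x0 x1 x2; by field.
Qed.

Lemma star1_perm (w : form1 R) :
  ((star1 w o1 o2 = w o0) * (star1 w o2 o1 = fun x => - w o0 x) *
   (star1 w o2 o0 = w o1) * (star1 w o0 o2 = fun x => - w o1 x) *
   (star1 w o0 o1 = w o2) * (star1 w o1 o0 = fun x => - w o2 x))%type.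
Proof.
by do ![split]; apply/funext => x; rewrite /star1 sum3 !levi_rep !leviE
  !scale0r ?scale1r ?scaleN1r ?addr0 ?add0r.
Qed.

Lemma lieNr u v : lie u (- v) = - lie u v.
Proof.
by rewrite !lieE; apply: eq_vec3; rewrite !(entryE, crossE, entryE); ring.
Qed.

(** The operator is the covariant divergence: each of the six permutations contributes the same sum
    up to its sign, which cancels the factor 1/6. The hypothesis is needed because half of the
    components of [star1 w] are opposites and must be differentiated as such. *)
Lemma star3_covd2_star1 (A w : form1 R) x :
  (forall a, pd a (fun y => - w a y) x = - pd a (w a) x) ->
  star3 (covd2 A (star1 w)) x = \sum_a (pd a (w a) x + lie (A a x) (w a x)).
Proof.
move=> wN; rewrite star3E sum3.
pose T a := pd a (w a) x + lie (A a x) (w a x).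
have TN a : pd a (fun y => - w a y) x + lie (A a x) (- w a x) = - T a.
  by rewrite wN lieNr -opprD.
pose X := T o0 + T o1 + T o2.
have E a b c : covd2 A (star1 w) a b c x =
    (pd a (star1 w b c) x + lie (A a x) (star1 w b c x))
  + (pd b (star1 w c a) x + lie (A b x) (star1 w c a x))
  + (pd c (star1 w a b) x + lie (A c x) (star1 w a b x)) by [].
have -> : covd2 A (star1 w) o0 o1 o2 x = X by rewrite E !star1_perm.
have -> : covd2 A (star1 w) o0 o2 o1 x = - X.
  by rewrite E !star1_perm !TN -!opprD addrAC.
have -> : covd2 A (star1 w) o1 o0 o2 x = - X.
  by rewrite E !star1_perm !TN -!opprD (addrC (T o1)).
have -> : covd2 A (star1 w) o1 o2 o0 x = X.
  by rewrite E !star1_perm -!/(T _) addrC addrA.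
have -> : covd2 A (star1 w) o2 o0 o1 x = X.
  by rewrite E !star1_perm -!/(T _) -addrA addrC.
have -> : covd2 A (star1 w) o2 o1 o0 x = - X.
  by rewrite E !star1_perm !TN -!opprD addrC addrA addrAC.
rewrite -/(T _) -/(T o1) -/(T o2) -/X; move: X => X.
by apply: eq_vec3; rewrite !entryE; by field.
Qed.

Lemma star3_covd2_hedge k P Q (dP dQ : R) x :
  is_derive (sq x) (1 : R) P dP -> is_derive (sq x) (1 : R) Q dQ ->
  star3 (covd2 (hedge_conn k) (star1 (hedge_form P Q))) x
  = (2 * dP + 2 * sq x * dQ + 4 * Q (sq x) - 4 * k (sq x) * P (sq x)) *: x.
Proof.
move=> DP DQ.
rewrite star3_covd2_star1; last by move=> a; exact: (pd_formN _ _ DP DQ).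
rewrite sum3 !(pd_form _ _ DP DQ) !lieE /hedge_form /hedge_conn.
apply: eq_vec3; do ![rewrite !(entryE, crossE, evecE)];
  move: (k (sq x)) (P (sq x)) (Q (sq x)) => y z w; rewrite sqE;
  move: (x o0 0) (x o1 0) (x o2 0) => x0 x1 x2; ring.
Qed.

End Hedgehog.

(** * Symmetry, regularity and reduction of the boundary value problem to the radial equations *)

Section Solution.
Set Implicit Arguments.
Unset Strict Implicit.
Unset Printing Implicit Defensive.
Context {R : realType}.
Local Notation V := 'cV[R]_3.
Implicit Types (x u v : V) (F G : V -> R) (a b c i : 'I_3) (k s P Q : R -> R).

Lemma det2 (M : 'M[R]_2) : \det M = M 0 0 * M 1 1 - M 0 1 * M 1 0.
Proof.
rewrite (expand_det_row _ 0) !big_ord_recl big_ord0 /cofactor !det_mx11 !mxE.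
have -> : lift 0 0 = 1 :> 'I_2 by exact: val_inj.
have -> : lift 1 0 = 0 :> 'I_2 by exact: val_inj.
rewrite /=; ring.
Qed.

Lemma det3 (M : 'M[R]_3) : \det M =
  M o0 o0 * (M o1 o1 * M o2 o2 - M o1 o2 * M o2 o1)
  - M o0 o1 * (M o1 o0 * M o2 o2 - M o1 o2 * M o2 o0)
  + M o0 o2 * (M o1 o0 * M o2 o1 - M o1 o1 * M o2 o0).
Proof.
rewrite (expand_det_row _ o0) sum3 /cofactor !det2 !mxE.
have -> : lift o0 0 = o1 :> 'I_3 by exact: val_inj.
have -> : lift o0 1 = o2 :> 'I_3 by exact: val_inj.
have -> : lift o1 0 = o0 :> 'I_3 by exact: val_inj.
have -> : lift o1 1 = o2 :> 'I_3 by exact: val_inj.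
have -> : lift o2 0 = o0 :> 'I_3 by exact: val_inj.
have -> : lift o2 1 = o1 :> 'I_3 by exact: val_inj.
rewrite /=; ring.
Qed.

Lemma mulmxE3 (M : 'M[R]_3) u i :
  (M *m u) i 0 = M i o0 * u o0 0 + M i o1 * u o1 0 + M i o2 * u o2 0.
Proof. by rewrite mxE sum3. Qed.

(** Pairing with a vector [w] turns both sides into the determinant of [M w, M u, M v]. For a
    rotation this is the equivariance of the cross product; a reflection would reverse the sign. *)
Lemma cross_mulmx (M : 'M[R]_3) u v :
  M^T *m cross (M *m u) (M *m v) = \det M *: cross u v.
Proof.
by apply: eq_vec3; rewrite !entryE mulmxE3 !crossE !mulmxE3 ![M^T _ _]mxE det3; ring.
Qed.

Lemma dotvE u v : dotv u v = (u^T *m v) 0 0.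
Proof. by rewrite /dotv mxE; apply: eq_bigr => i _; rewrite mxE. Qed.

Lemma SO3P (M : 'M[R]_3) : SO3 M ->
  [/\ forall u, M *m (invmx M *m u) = u, forall u, sq (invmx M *m u) = sq u &
      forall u v, M *m cross (invmx M *m u) (invmx M *m v) = cross u v].
Proof.
move=> [MT dM]; have uM : M \in unitmx by rewrite unitmxE dM unitr1.
have K u : M *m (invmx M *m u) = u by rewrite mulKVmx.
have E : invmx M = M^T.
  by rewrite -[LHS]mulmx1 -MT mulmxA mulVmx// mul1mx.
split=> // [u|u v].
  by rewrite /sq !dotvE E trmx_mul trmxK mulmxA -(mulmxA u^T) MT mulmx1.
have := cross_mulmx M (invmx M *m u) (invmx M *m v).
by rewrite dM scale1r !K => <-; rewrite mulmxA MT mul1mx.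
Qed.

Lemma eval1_conn k x v : eval1 (hedge_conn k) x v = k (sq x) *: cross x v.
Proof.
rewrite /eval1 sum3 /hedge_conn.
by apply: eq_vec3; rewrite !(entryE, crossE, evecE); ring.
Qed.

Lemma eval1_form P Q x v :
  eval1 (hedge_form P Q) x v = P (sq x) *: v + (Q (sq x) * dotv x v) *: x.
Proof.
rewrite /eval1 sum3 /hedge_form /dotv sum3.
by apply: eq_vec3; rewrite !(entryE, evecE); ring.
Qed.

Lemma hedgehog_symmetric k s :
  spherically_symmetric (hedge_conn k) (hedge_higgs s).
Proof.
move=> M /SO3P [K iso rot] x _; split.
  by rewrite /rot_higgs /hedge_higgs -scalemxAr iso K.
by move=> a; rewrite /rot_conn eval1_conn -scalemxAr iso rot.
Qed.

Lemma C2_cross a i : C2fun (fun x => cross x (evec a) i 0).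
Proof.
have gen j l (p q : R) : C2fun (fun y : V => y j 0 * p - y l 0 * q).
  have -> : (fun y : V => y j 0 * p - y l 0 * q) =
     (fun y : V => y j 0) * cst p + (fun y : V => y l 0) * cst (- q).
    by apply/funext => y; rewrite -mulrN.
  by apply: C2funD; apply: C2funM; [exact: C2_coord|exact: C2fun_cst|
    exact: C2_coord|exact: C2fun_cst].
move: i; apply: I3_ind.
- have -> : (fun x => cross x (evec a) o0 0) = 
    (fun y => y o1 0 * evec a o2 0 - y o2 0 * evec a o1 0); last exact: gen.
  by apply/funext => y; rewrite crossE.
- have -> : (fun x => cross x (evec a) o1 0) = 
    (fun y => y o2 0 * evec a o0 0 - y o0 0 * evec a o2 0); last exact: gen.
  by apply/funext => y; rewrite crossE.
- have -> : (fun x => cross x (evec a) o2 0) = 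
    (fun y => y o0 0 * evec a o1 0 - y o1 0 * evec a o0 0); last exact: gen.
  by apply/funext => y; rewrite crossE.
Qed.

Lemma sq_ge0 x : 0 <= sq x.
Proof. by rewrite sqE !addr_ge0// sqr_ge0. Qed.

Lemma enorm_sqr x : enorm x ^+ 2 = sq x.
Proof. by rewrite /enorm sqr_sqrtr//; exact: sq_ge0. Qed.

Lemma cross_radial (p q r : R) u x :
  cross (p *: u + q *: x) (r *: x) = (- (p * r)) *: cross x u.
Proof. by apply: eq_vec3; rewrite !(entryE, crossE, entryE); ring. Qed.

(** Both sides of the first equation are multiples of [cross x (evec a)], and both sides of the
    second are multiples of [x], so each vector equation is one scalar equation at [t = sq x]. *)
Theorem hedgehog_solves (lambda eps : R) (k k' k'' s s' s'' : R -> R) :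
  (forall t : R, is_derive t (1 : R) k (k' t)) ->
  (forall t : R, is_derive t (1 : R) k' (k'' t)) -> continuous k'' ->
  (forall t : R, is_derive t (1 : R) s (s' t)) ->
  (forall t : R, is_derive t (1 : R) s' (s'' t)) -> continuous s'' ->
  1 + 2 * k 1 = 0 -> s 1 = 1 ->
  (forall t, 0 <= t -> t <= 1 ->
    eps * (4 * t * k'' t + 10 * k' t - 6 * k t ^+ 2 - 4 * t * k t ^+ 3)
    = 2 * s t ^+ 2 * (1 + 2 * t * k t)) ->
  (forall t, 0 <= t -> t <= 1 ->
    4 * t * s'' t + 10 * s' t - 8 * k t * s t - 8 * t * k t ^+ 2 * s t
    = lambda / 2 * (t * s t ^+ 2 - 1) * s t) ->
  [/\ forall a, classical_reg (hedge_conn k a),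
      classical_reg (hedge_higgs s),
      spherically_symmetric (hedge_conn k) (hedge_higgs s) &
      solves_bvp lambda eps (hedge_conn k) (hedge_higgs s)].
Proof.
move=> Dk Dk' ck'' Ds Ds' cs'' k1 s1 odek odes.
have C2k : C2fun (k \o sq) := C2_radial Dk Dk' ck''.
have C2s : C2fun (s \o sq) := C2_radial Ds Ds' cs''.
have ball1 x : enorm x <= 1 -> sq x <= 1.
  by move=> h; rewrite -enorm_sqr expr_le1 ?ler0n // /enorm sqrtr_ge0.
have covd0E : covd0 (hedge_conn k) (hedge_higgs s) =
    hedge_form (fun t => s t * (1 + 2 * t * k t)) (fun t => 2 * (s' t - k t * s t)).
  by apply/funext => c; apply/funext => x; exact: covd0_hedge.
have curvE : star2 (curv (hedge_conn k)) =
    hedge_form (fun t => 2 * (t * k' t + k t)) (fun t => 2 * (k t ^+ 2 - k' t)).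
  by apply/funext => c; apply/funext => x; exact: star2_curv_conn.
split.
- move=> a.
  have -> : hedge_conn k a =
      fun x => (\col_i ((k \o sq) * (fun y => cross y (evec a) i 0)) x : V).
    by apply/funext => x; apply/matrixP => i j; rewrite (ord1 j) entryZ [RHS]mxE.
  by apply: classical_reg_col => i; exact: (C2funM C2k (C2_cross a i)).
- have -> : hedge_higgs s =
      fun x => (\col_i ((s \o sq) * (fun y : V => y i 0)) x : V).
    by apply/funext => x; apply/matrixP => i j; rewrite (ord1 j) entryZ [RHS]mxE.
  by apply: classical_reg_col => i; exact: (C2funM C2s (C2_coord i)).
- exact: hedgehog_symmetric.
split.
- move=> a x /ltW /ball1 x1.
  have DP (t : R) : is_derive t (1 : R) (fun t => 2 * (t * k' t + k t))
      (2 * (t * k'' t + 2 * k' t)).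
    have -> : (fun t => 2 * (t * k' t + k t)) = cst 2 * (id * k' + k) by [].
    by apply: is_derive_eq; rewrite !fctE /GRing.scale /=; ring.
  have DQ (t : R) : is_derive t (1 : R) (fun t => 2 * (k t ^+ 2 - k' t))
      (2 * (2 * k t * k' t - k'' t)).
    have -> : (fun t => 2 * (k t ^+ 2 - k' t)) = cst 2 * (k * k - k') by [].
    by apply: is_derive_eq; rewrite !fctE /GRing.scale /=; ring.
  rewrite curvE (star2_covd1_hedge _ _ (DP _) (DQ _)) covd0E lieE.
  rewrite /hedge_form /hedge_higgs cross_radial !scalerA; congr (_ *: _).
  have E := odek _ (sq_ge0 x) x1.
  transitivity (- (eps * (4 * sq x * k'' (sq x) + 10 * k' (sq x)
    - 6 * k (sq x) ^+ 2 - 4 * sq x * k (sq x) ^+ 3))); first by ring.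
  by rewrite E; ring.
- move=> x /ltW /ball1 x1.
  have DP (t : R) : is_derive t (1 : R) (fun t => s t * (1 + 2 * t * k t))
      (s' t * (1 + 2 * t * k t) + s t * (2 * k t + 2 * t * k' t)).
    have Dt : is_derive t (1 : R) (cst 1 + cst 2 * (id * k)) (2 * k t + 2 * t * k' t).
      by apply: (is_derive_eq (is_deriveD (is_derive_cst _ _ _) (is_deriveM
        (is_derive_cst _ _ _) (is_deriveM (is_derive_id _ _) (Dk t)))));
        rewrite !fctE /GRing.scale /=; ring.
    have -> : (fun t => s t * (1 + 2 * t * k t)) = s * (cst 1 + cst 2 * (id * k)).
      by apply/funext => u; rewrite !fctE mulrA.
    by apply: (is_derive_eq (is_deriveM (Ds t) Dt)); rewrite !fctE /GRing.scale /=; ring.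
  have DQ (t : R) : is_derive t (1 : R) (fun t => 2 * (s' t - k t * s t))
      (2 * (s'' t - k' t * s t - k t * s' t)).
    have -> : (fun t => 2 * (s' t - k t * s t)) = cst 2 * (s' - k * s) by [].
    by apply: is_derive_eq; rewrite !fctE /GRing.scale /=; ring.
  rewrite covd0E (star3_covd2_hedge _ (DP _) (DQ _)) enorm_sqr.
  have sqZ (r : R) : sq (r *: x) = sq x * r ^+ 2 by rewrite !sqE !entryE; ring.
  rewrite [sq (hedge_higgs s x)]sqZ.
  rewrite /hedge_higgs scalerA; congr (_ *: _).
  by rewrite -(odes _ (sq_ge0 x) x1); ring.
- move=> x v x1 xv; rewrite covd0E.
  have [[ck _] _] := C2k; have [[cs cs1] _] := C2s.
  (* At a boundary point [P 1 = 0] by the condition on [k 1], and the [Q] term vanishes on tangent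
     vectors. Since [f] is continuous on the whole space, the limit from inside the ball is its
     value. *)
  pose P t := s t * (1 + 2 * t * k t); pose Q t := 2 * (s' t - k t * s t).
  pose f y : V := P (sq y) *: v + (Q (sq y) * dotv y v) *: y.
  have sx : sq x = 1 by rewrite -enorm_sqr x1 expr1n.
  have fx : f x = 0.
    by rewrite /f sx /P xv mulr0 scale0r addr0 mulr1 k1 mulr0 scale0r.
  have cf : {for x, continuous f}.
    have cs' : continuous (s' \o sq).
      have cs' : continuous s'.
        by move=> t; apply/differentiable_continuous/derivable1_diffP; have [] := Ds' t.
      by move=> y; apply: continuous_comp; [exact: continuous_sq|exact: cs'].
    have cdot : continuous (fun y => dotv y v).
      have -> : (fun y => dotv y v) = (fun y : V => y o0 0) * cst (v o0 0)
          + (fun y : V => y o1 0) * cst (v o1 0) + (fun y : V => y o2 0) * cst (v o2 0).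
        by apply/funext => y; rewrite /dotv sum3.
      by move=> y; apply: continuousD; [apply: continuousD|]; apply: continuousM;
        (exact: coord_continuous || exact: cst_continuous).
    have cP : continuous (P \o sq).
      have -> : P \o sq = (s \o sq) * (cst 1 + cst 2 * sq * (k \o sq)) by [].
      move=> y; apply: continuousM; first exact: cs.
      apply: continuousD; first exact: cst_continuous.
      apply: continuousM; last exact: ck.
      by apply: continuousM; [exact: cst_continuous|exact: continuous_sq].
    have cQ : continuous (Q \o sq).
      have -> : Q \o sq = cst 2 * ((s' \o sq) - (k \o sq) * (s \o sq)) by [].
      move=> y; apply: continuousM; first exact: cst_continuous.
      apply: continuousB; first exact: cs'.
      by apply: continuousM; [exact: ck|exact: cs].
    have cdotQ : {for x, continuous ((Q \o sq) * (fun y => dotv y v))}.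
      by apply: continuousM; [exact: cQ|exact: cdot].
    apply: (@continuousD _ _ _ (fun y => P (sq y) *: v)
      (fun y => (Q (sq y) * dotv y v) *: y)).
    - by apply: (continuousZ (s := P \o sq) (f := cst v)); [exact: cP|exact: cst_continuous].
    - by apply: (continuousZ (f := id) cdotQ); exact: cvg_id.
  rewrite -fx; apply: cvg_within_filter.
  have -> : (fun y => eval1 (hedge_form P Q) y v) = f.
    by apply/funext => y; exact: eval1_form.
  exact: cf.
- move=> x x1; rewrite /enorm -/(sq _).
  have sx : sq x = 1 by rewrite -enorm_sqr x1 expr1n.
  by rewrite /hedge_higgs sx s1 scale1r sx sqrtr1.
Qed.

End Solution.

(** * Transfer of the profiles from the Stdlib reals, and conclusion *)

Local Notation RR := (Rdefinitions.R : realType).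

Lemma is_derive_of_derivable_pt_lim (f : RR -> RR) (x l : RR) :
  Ranalysis1.derivable_pt_lim f x l -> is_derive x (1 : RR) f l.
Proof.
move=> D.
suff h : (fun h : RR => h^-1 *: ((f \o shift x) (h *: 1) - f x)) @ 0^' --> l.
  by apply: DeriveDef; [apply/cvg_ex; exists l|exact/cvg_lim].
apply/cvgrPdist_lt => e e0; have /RltP e0' := e0.
have [d hd] := D e e0'.
have d0 : 0 < RIneq.pos d by apply/RltP; case: d {hd}.
near=> h.
have h0 : h != 0 by near: h; exact: nbhs_dnbhs_neq.
have hl : `|h| < RIneq.pos d.
  by near: h; apply: dnbhs0_lt.
have hl' : Rdefinitions.Rlt (Rbasic_fun.Rabs h) (RIneq.pos d)
  by apply/RltP; rewrite RabsE.
have h0' : h <> 0 by apply/eqP.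
have /RltP := hd h h0' hl'.
rewrite RabsE RdivE => H.
by rewrite /= [_ *: 1]mulr1 distrC (addrC h x) [_ *: _]mulrC.
Unshelve. all: by end_near. Qed.

Theorem theorem5p1 (lambda eps : Rdefinitions.R)
    (hlambda : 0 <= lambda) (heps : 0 < eps) :
  exists (A : form1 Rdefinitions.R) (phi : form0 Rdefinitions.R),
    [/\ forall a : 'I_3, classical_reg (A a),
        classical_reg phi,
        spherically_symmetric A phi &
        solves_bvp lambda eps A phi].
Proof.
(* The Stdlib reals are themselves a [realType], so only derivatives, continuity, order, powers,
   division and numerals have to be translated. *)
have /RleP hl := hlambda; have /RltP he := heps.
have [k [k' [k'' [s [s' [s'' [[Dk [Dk' [ck k1]]] [[Ds [Ds' [cs s1]]] ode]]]]]]]] :=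
  Radial.radial_profile lambda eps hl he.
exists (hedge_conn k), (hedge_higgs s).
apply: (@hedgehog_solves _ lambda eps k k' k'' s s' s'').
- by move=> t; exact: is_derive_of_derivable_pt_lim.
- by move=> t; exact: is_derive_of_derivable_pt_lim.
- by move=> t; apply/continuity_ptE; exact: ck.
- by move=> t; exact: is_derive_of_derivable_pt_lim.
- by move=> t; exact: is_derive_of_derivable_pt_lim.
- by move=> t; apply/continuity_ptE; exact: cs.
- by move: k1; rewrite !IZRposE !INRE.
- by move: s1; rewrite !IZRposE !INRE.
- move=> t /RleP t0 /RleP t1; have [E _] := ode t (conj t0 t1).
  by move: E; rewrite !RpowE !IZRposE !INRE.
- move=> t /RleP t0 /RleP t1; have [_ E] := ode t (conj t0 t1).
  by move: E; rewrite !RpowE !RdivE !IZRposE !INRE.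
Qed.
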